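(* Let $(X,\mathrm{d}\mu)$ be a $\sigma$-finite measure space and, for $1\le j\le d$, let $\mathcal{Y}_j$ be a $p_j$-convex normed lattice for some $1\le p_j<\infty$. Let $T_j:\mathcal{Y}_j\to\mathcal{M}(X)$ be positive linear operators, each of which saturates $X$. Let $\theta_j>0$ with $\sum_{j=1}^d\theta_j=1$. Suppose that $$\int_X\prod_{j=1}^d(T_jf_j)(x)^{p_j\theta_j}\,\mathrm{d}\mu(x)\le B\prod_{j=1}^d\|f_j\|_{\mathcal{Y}_j}^{p_j\theta_j}$$ for all nonnegative $f_j\in\mathcal{Y}_j$, $1\le j\le d$. Then there exist nonnegative measurable functions $\phi_1,\dots,\phi_d$ on $X$ such that $$\prod_{j=1}^d\phi_j(x)^{\theta_j}\ge 1\quad\text{for a.e. }x\in X,$$ and such that for each $j$, $$\left(\int_X|T_jf_j(x)|^{p_j}\phi_j(x)\,\mathrm{d}\mu(x)\right)^{1/p_j}\le B^{1/p_j}C_{p_j}(\mathcal{Y}_j)\|f_j\|_{\mathcal{Y}_j}\quad\text{for all } f_j\in\mathcal{Y}_j.$$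
   Context: $\mathcal{M}(X)$ is the class of measurable functions on $X$. A linear operator is positive if it maps nonnegative elements to (a.e.) nonnegative functions. A linear map $T:\mathcal{Y}\to\mathcal{M}(X)$ saturates $X$ if for each measurable $E\subseteq X$ of positive measure there exist a measurable $E'\subseteq E$ with $\mu(E')>0$ and an $h\in\mathcal{Y}$ such that $|Th|>0$ a.e. on $E'$. For $1\le p<\infty$, a normed lattice $\mathcal{Y}$ is $p$-convex if there is a finite constant $C$ such that for all finite sequences $(f_k)$ in $\mathcal{Y}$, $\big\|(\sum_k|f_k|^p)^{1/p}\big\|_{\mathcal{Y}}\le C(\sum_k\|f_k\|_{\mathcal{Y}}^p)^{1/p}$; the least such constant is denoted $C_p(\mathcal{Y})$. Here $(\sum_k|f_k|^p)^{1/p}\in\mathcal{Y}$ is understood in the usual sense of lattice functional calculus (pointwise in a lattice of functions). *)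

(* Defs.v *)
From HB Require Import structures.
From mathcomp Require Import all_boot all_order all_algebra.
From mathcomp Require Import all_classical all_reals all_analysis.

Set Implicit Arguments.
Unset Strict Implicit.
Unset Printing Implicit Defensive.

Import Order.TTheory GRing.Theory Num.Theory.
Import numFieldNormedType.Exports.

Local Open Scope classical_set_scope.
Local Open Scope ring_scope.

(* Real normed lattices (normed Riesz spaces), not assumed complete. The order
   operations are fields rather than being inherited from Order.Lattice, because
   Hierarchy Builder accepts no join of NormedModule and the order structures
   once Num.NumDomain exists. The instances declared below make the order and
   lattice operations of the library available on every normed lattice. *)
HB.mixin Record NormedModule_isNormedLattice (R : realType) V
    of NormedModule R V := {
  nlat_le : rel V ;
  nlat_meet : V -> V -> V ;
  nlat_join : V -> V -> V ;
  nlat_le_refl : reflexive nlat_le ;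
  nlat_le_anti : antisymmetric nlat_le ;
  nlat_le_trans : transitive nlat_le ;
  nlat_meetP : forall x y z : V,
    nlat_le x (nlat_meet y z) = nlat_le x y && nlat_le x z ;
  nlat_joinP : forall x y z : V,
    nlat_le (nlat_join x y) z = nlat_le x z && nlat_le y z ;
  nlat_leD : forall x y z : V, nlat_le x y -> nlat_le (x + z) (y + z) ;
  nlat_leZ : forall (a : R) (x y : V),
    0 <= a -> nlat_le x y -> nlat_le (a *: x) (a *: y) ;
  (* |x| <= |y| implies ||x|| <= ||y||, with modulus |x| = x \/ (- x) *)
  nlat_le_norm : forall x y : V,
    nlat_le (nlat_join x (- x)) (nlat_join y (- y)) -> `|x| <= `|y|
}.

#[short(type="normedLatticeType")]
HB.structure Definition NormedLattice (R : realType) :=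
  { V of NormedModule R V & NormedModule_isNormedLattice R V }.

HB.instance Definition _ (R : realType) (V : normedLatticeType R) :=
  Order.Le_isPOrder.Build ring_display V
    (@nlat_le_refl R V) (@nlat_le_anti R V) (@nlat_le_trans R V).

HB.instance Definition _ (R : realType) (V : normedLatticeType R) :=
  Order.POrder_MeetJoin_isLattice.Build ring_display V
    (@nlat_meetP R V) (@nlat_joinP R V).

(* The space H_n of continuous positively homogeneous functions on R^n. *)
Definition homog_fun (R : realType) (n : nat) : set ('rV[R]_n -> R) :=
  [set h | continuous h /\
           forall (a : R) (v : 'rV[R]_n), 0 <= a -> h (a *: v) = a * h v].

(* Phi, restricted to L, is a functional calculus for f_0, ..., f_{n-1}: L is a
   vector sublattice of H_n containing the coordinate functions, and Phi is a
   linear lattice homomorphism on L sending the k-th coordinate to f_k. The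
   values of Phi outside L are irrelevant. *)
Record lattice_calculus (R : realType) (Y : normedLatticeType R) (n : nat)
    (f : 'I_n -> Y) (L : set ('rV[R]_n -> R)) (Phi : ('rV[R]_n -> R) -> Y)
    : Prop := LatticeCalculus {
  lcalc_sub : L `<=` @homog_fun R n ;
  lcalc_coord : forall k, L (fun v => v ord0 k) ;
  lcalc_lin : forall (a : R) u v, L u -> L v -> L (fun t => a * u t + v t) ;
  lcalc_max : forall u v, L u -> L v -> L (fun t => Num.max (u t) (v t)) ;
  lcalc_min : forall u v, L u -> L v -> L (fun t => Num.min (u t) (v t)) ;
  lcalc_morph_coord : forall k, Phi (fun v => v ord0 k) = f k ;
  lcalc_morph_lin : forall (a : R) u v, L u -> L v ->
    Phi (fun t => a * u t + v t) = a *: Phi u + Phi v ;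
  lcalc_morph_max : forall u v, L u -> L v ->
    Phi (fun t => Num.max (u t) (v t)) = Order.join (Phi u) (Phi v) ;
  lcalc_morph_min : forall u v, L u -> L v ->
    Phi (fun t => Num.min (u t) (v t)) = Order.meet (Phi u) (Phi v)
}.

(* g = h(f_0, ..., f_{n-1}) in Y. Taking L = H_n is the Krivine calculus of a
   Banach lattice. A normed lattice need not be closed under all of H_n, so h is
   only required to lie in some L on which the calculus is Y-valued; in a lattice
   of functions this says that the pointwise h(f_0(x), ..., f_{n-1}(x)) is in Y.
   Such a g is unique: lattice-linear expressions in the coordinates approximate
   h uniformly relative to the sum of their absolute values. *)
Definition lattice_value (R : realType) (Y : normedLatticeType R) (n : nat)
    (f : 'I_n -> Y) (h : 'rV[R]_n -> R) (g : Y) : Prop :=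
  exists L Phi, [/\ lattice_calculus f L Phi, L h & Phi h = g].

Definition lp_norm (R : realType) (p : R) (n : nat) (v : 'rV[R]_n) : R :=
  (\sum_(k < n) `|v ord0 k| `^ p) `^ p^-1.

(* The convexity inequality with constant C; it includes that
   (sum_k |f_k|^p)^(1/p) exists in Y. *)
Definition p_convex_with (R : realType) (p : R) (Y : normedLatticeType R)
    (C : R) : Prop :=
  forall (n : nat) (f : 'I_n -> Y), exists2 g : Y,
    lattice_value f (@lp_norm R p n) g &
    `|g| <= C * (\sum_(k < n) `|f k| `^ p) `^ p^-1.

Definition p_convex (R : realType) (p : R) (Y : normedLatticeType R) : Prop :=
  exists C : R, 0 <= C /\ p_convex_with p Y C.

Definition p_convexity_const (R : realType) (p : R) (Y : normedLatticeType R)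
    : R := inf [set C : R | 0 <= C /\ p_convex_with p Y C].

(* Linearity into M(X), whose elements are identified when equal a.e. *)
Definition ae_linear (R : realType) (Y : normedLatticeType R)
    (disp : measure_display) (X : measurableType disp)
    (mu : {measure set X -> \bar R}) (T : Y -> {mfun X >-> R}) : Prop :=
  forall (a : R) (f g : Y),
    {ae mu, forall x, T (a *: f + g) x = a * T f x + T g x}.

Definition positive_op (R : realType) (Y : normedLatticeType R)
    (disp : measure_display) (X : measurableType disp)
    (mu : {measure set X -> \bar R}) (T : Y -> {mfun X >-> R}) : Prop :=
  forall f : Y, 0 <= f -> {ae mu, forall x, 0 <= T f x}.

Definition saturates (R : realType) (Y : normedLatticeType R)
    (disp : measure_display) (X : measurableType disp)
    (mu : {measure set X -> \bar R}) (T : Y -> {mfun X >-> R}) : Prop :=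
  forall E : set X, measurable E -> (0 < mu E)%E ->
  exists E' : set X, [/\ measurable E', E' `<=` E, (0 < mu E')%E &
    exists h : Y, {ae mu, forall x, E' x -> 0 < `|T h x|}].

(* Main.v *)
Require Import Defs.
From HB Require Import structures.
From mathcomp Require Import all_boot all_order all_algebra.
From mathcomp Require Import all_classical all_reals all_analysis.
From mathcomp Require Import measurable_realfun ring lra.

(** For each [j], let [G j] be the set of the functions [\sum_k c_k * |T_j f_k| ^ p_j]
    with [c_k >= 0] and [\sum_k c_k * (C_j * norm f_k) ^ p_j <= 1], [C_j] being the
    convexity constant. It is convex. A positive operator satisfies
    [(\sum_k |T f_k| ^ p) ^ (1 / p) <= T ((\sum_k |f_k| ^ p) ^ (1 / p))] almost
    everywhere ([ae_positive_lp_value]), so by [p_j]-convexity the hypothesis on the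
    [T_j] becomes [\int \prod_j g_j ^ theta_j <= B] for all [g_j] in [G j]
    ([power_sums_bound]). It remains to disentangle this multilinear bound into
    [\int g * phi_j <= B] for all [g] in [G j], with [\prod_j phi_j ^ theta_j >= 1]
    ([disentangling_weights]).

    If the concave functional [\int \prod_j g_j ^ theta_j] has a maximiser [g] with all
    [g_j > 0], then [phi_j = (\prod_i g_i ^ theta_i) / g_j] does it, the inequalities
    being the first-order conditions. In general maximisers need not exist. After
    shifting the [G j] slightly towards a fixed selection [a], and keeping only the
    members bounded by a multiple of [a], the increments have quadratic remainders, and
    a near-maximiser gives the weights up to an error ([near_maximizer_weights]).

    The approximate problems are indexed by [a] and by the size of the error. Their
    solution sets are midpoint convex, and they decrease along a directed order. No
    countable subfamily need exhaust the constraints, as the measure space need not be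
    separable. Instead the strictly convex functional [\int \sum_j exp (- phi_j)] selects
    a limit: its near-minimisers are Cauchy by a parallelogram identity, and their limit
    does not depend on the index that is imposed ([directed_midpoint_convex_limit]).
    Fatou's lemma carries the bounds to the limit. Saturation shows that the limit is
    finite, since an infinite weight would violate the bound, and that the constraint on
    the product holds almost everywhere. *)

Set Implicit Arguments.
Unset Strict Implicit.
Unset Printing Implicit Defensive.

Import Order.TTheory GRing.Theory Num.Theory.
Import numFieldNormedType.Exports.

Local Open Scope classical_set_scope.
Local Open Scope ring_scope.

(** * Inequalities for real powers *)

(** Bernoulli's inequality for exponents at most [1], as Young's inequality with
    second factor [1]. *)
Lemma powR_le_tangent (R : realType) (t s : R) :
  0 < t -> t <= 1 -> -1 <= s -> (1 + s) `^ t <= 1 + t * s.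
Proof.
move=> t0; rewrite le_eqVlt => /predU1P[->|t1] s1.
  by rewrite powRr1 ?mul1r//; lra.
have s0 : 0 <= 1 + s by lra.
have := @conjugate_powR R ((1 + s) `^ t) 1 t^-1 (1 - t)^-1 (powR_ge0 _ _) ler01.
rewrite !invr_gt0 !invrK -powRrM mulfV ?gt_eqF// powRr1// powR1 mulr1.
move=> /(_ t0); rewrite subr_gt0 => /(_ t1).
have -> : t + (1 - t) = 1 by ring.
move=> /(_ erefl) H; apply: (le_trans H); lra.
Qed.

(** Dividing [1 + s = (1 + s) ^ t * (1 + s) ^ (1 - t)] by the tangent bound on the second
    factor controls the loss in the tangent bound on the first. The explicit quadratic
    remainder is what allows an approximate maximiser to play the part of a maximiser. *)
Lemma powR_ge_second_order (R : realType) (t s : R) :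
  0 < t -> t <= 1 -> - 2^-1 <= s -> 1 + t * s - 2 * s ^+ 2 <= (1 + s) `^ t.
Proof.
move=> t0; rewrite le_eqVlt => /predU1P[->|t1] s1.
  by rewrite powRr1; nra.
have s0 : 0 < 1 + s by lra.
have h : (1 + s) `^ (1 - t) <= 1 + (1 - t) * s by apply: powR_le_tangent; lra.
have e : (1 + s) `^ t * (1 + s) `^ (1 - t) = 1 + s.
  rewrite -powRD; last by rewrite (gt_eqF s0) implybT.
  by rewrite (_ : t + (1 - t) = 1) ?powRr1 ?ltW//; ring.
have y0 : 0 < (1 + s) `^ t by exact: powR_gt0.
set y := (1 + s) `^ t in e y0 *.
have {}h : 1 + s <= y * (1 + (1 - t) * s) by rewrite -{1}e ler_pM2l.
have D0 : 2^-1 <= 1 + (1 - t) * s by nra.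
set D := 1 + (1 - t) * s in h D0 *.
rewrite -(ler_pM2r (lt_le_trans _ D0)); last by lra.
apply: le_trans h.
have -> : (1 + t * s - 2 * s ^+ 2) * D = 1 + s + (t * (1 - t) - 2 * D) * s ^+ 2.
  by rewrite /D; ring.
have : (t * (1 - t) - 2 * D) * s ^+ 2 <= 0 by apply: mulr_le0_ge0; nra.
lra.
Qed.

Lemma young_powR (R : realType) (p x y : R) : 1 <= p -> 0 <= x -> 0 <= y ->
  x `^ (p - 1) * y <= (1 - p^-1) * x `^ p + p^-1 * y `^ p.
Proof.
rewrite le_eqVlt => /predU1P[<-|p1] x0 y0.
  by rewrite subrr powRr0 invr1 subrr !powRr1//; lra.
have p0 : 0 < p by lra.
have p10 : 0 < p - 1 by lra.
have := @conjugate_powR R y (x `^ (p - 1)) p (p / (p - 1)) y0 (powR_ge0 _ _) p0.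
rewrite divr_gt0// => /(_ erefl); rewrite invf_div.
have -> : p^-1 + (p - 1) / p = 1 by field; rewrite gt_eqF.
move=> /(_ erefl); rewrite mulrC => /le_trans; apply.
rewrite -powRrM.
have -> : (p - 1) * (p / (p - 1)) = p by field; rewrite gt_eqF.
have -> : (p - 1) / p = 1 - p^-1 by field; rewrite gt_eqF.
lra.
Qed.

Lemma ge0_powR_div (R : realType) (p x a : R) : 0 <= x -> 0 <= a ->
  (x / a) `^ p = x `^ p / a `^ p.
Proof.
by move=> x0 a0; rewrite powRM// ?invr_ge0// -(powR_inv1 a0) powRAC powR_inv1// powR_ge0.
Qed.

Lemma powR_root (R : realType) (p A : R) : 1 <= p -> 0 < A ->
  exists a : R, [/\ 0 < a, a `^ p = A, A `^ p^-1 = a & A `^ (1 - p^-1) = a `^ (p - 1)].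
Proof.
move=> p1 A0; have p0 : p != 0 by rewrite gt_eqF//; lra.
exists (A `^ p^-1); split => //; first exact: powR_gt0.
  by rewrite -powRrM mulVf// powRr1// ltW.
by rewrite -powRrM mulrBr mulVf// mulr1.
Qed.

(** For fixed [b] the left-hand side is a tangent functional of the l^p norm, written
    without normalising [b]. *)
Lemma holder_lp_norm (R : realType) (p : R) (n : nat) (b : 'I_n -> R)
    (v : 'rV[R]_n) : 1 <= p -> (forall k, 0 <= b k) ->
    0 < \sum_(k < n) b k `^ p ->
  \sum_(k < n) b k `^ (p - 1) * v ord0 k <=
  (\sum_(k < n) b k `^ p) `^ (1 - p^-1) * lp_norm p v.
Proof.
move=> p1 b0; rewrite /lp_norm.
set A := \sum_(k < n) _; set V := \sum_(k < n) `|_| `^ _ => A0.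
have p0 : 0 < p by lra.
have pn0 : p != 0 by rewrite gt_eqF.
apply: (@le_trans _ _ (\sum_(k < n) b k `^ (p - 1) * `|v ord0 k|)).
  by apply: ler_sum => k _; rewrite ler_wpM2l ?powR_ge0// ler_norm.
have : 0 <= V by apply: sumr_ge0 => k _; exact: powR_ge0.
rewrite le_eqVlt => /predU1P[/esym V0|V0].
  rewrite big1 ?mulr_ge0 ?powR_ge0// => k _.
  have /eqP := V0; rewrite psumr_eq0; last by move=> *; exact: powR_ge0.
  move=> /allP /(_ k (mem_index_enum _)); rewrite implyTb powR_eq0 => /andP[/eqP-> _].
  by rewrite mulr0.
have [a [a0 ap _ ->]] := powR_root p1 A0.
have [w [w0 wp -> _]] := powR_root p1 V0.
have key : \sum_(k < n) (b k / a) `^ (p - 1) * (`|v ord0 k| / w) <= 1.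
  apply: (@le_trans _ _ (\sum_(k < n) ((1 - p^-1) * (b k / a) `^ p +
      p^-1 * (`|v ord0 k| / w) `^ p))).
    apply: ler_sum => k _; apply: young_powR => //.
      exact: (divr_ge0 (b0 k) (ltW a0)).
    exact: (divr_ge0 (normr_ge0 _) (ltW w0)).
  rewrite big_split/= -!mulr_sumr.
  have -> : \sum_(k < n) (b k / a) `^ p = 1.
    transitivity (A / A); last by rewrite divff// lt0r_neq0.
    rewrite {1}/A mulr_suml.
    apply: eq_bigr => k _.
    by rewrite (ge0_powR_div p (b0 k) (ltW a0)) ap.
  have -> : \sum_(k < n) (`|v ord0 k| / w) `^ p = 1.
    transitivity (V / V); last by rewrite divff// lt0r_neq0.
    rewrite {1}/V mulr_suml.
    apply: eq_bigr => k _.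
    by rewrite (ge0_powR_div p (normr_ge0 _) (ltW w0)) wp.
  by rewrite !mulr1 subrK.
have -> : \sum_(k < n) b k `^ (p - 1) * `|v ord0 k| =
    a `^ (p - 1) * w * \sum_(k < n) (b k / a) `^ (p - 1) * (`|v ord0 k| / w).
  rewrite mulr_sumr; apply: eq_bigr => k _.
  rewrite (ge0_powR_div _ (b0 k) (ltW a0)).
  by field; rewrite !gt_eqF// powR_gt0.
by rewrite ger_pMr// mulr_gt0// powR_gt0.
Qed.

(** A grid point [b] just above [v] almost attains Hoelder's inequality: replacing
    [v] by [b - N.+1^-1] costs at most [n / N.+1]. Countably many tangents thus
    recover the l^p norm, so the conclusion survives almost everywhere arguments. *)
Lemma powR_sum_le_of_tangents (R : realType) (p : R) (n : nat) (v : 'I_n -> R)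
    (y : R) : 1 <= p -> (forall k, 0 <= v k) ->
  (forall b : 'I_n -> R, (exists (N : nat) (m : 'I_n -> nat),
      b = fun k => (m k).+1%:R / N.+1%:R) ->
    \sum_(k < n) b k `^ (p - 1) * v k <= (\sum_(k < n) b k `^ p) `^ (1 - p^-1) * y) ->
  0 <= y -> \sum_(k < n) v k `^ p <= y `^ p.
Proof.
move=> p1 v0 H y0.
have p0 : 0 < p by lra.
have pn0 : p != 0 by rewrite gt_eqF.
case: n v v0 H => [|n] v v0 H; first by rewrite big_ord0 powR_ge0.
set V := \sum_(k < _) _.
have V0 : 0 <= V by apply: sumr_ge0 => k _; exact: powR_ge0.
suff : V `^ p^-1 <= y.
  move=> /(ge0_ler_powR (ltW p0)); rewrite !nnegrE -powRrM mulVf// powRr1//.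
  by apply; rewrite ?powR_ge0.
apply/ler_addgt0Pr => e e0.
(* The mesh [d = N.+1^-1] satisfies [n * d <= e], and [b] rounds [v] up to it. *)
have [N NE] : exists N : nat, n.+1%:R / e < N.+1%:R.
  exists (Num.truncn (n.+1%:R / e)); exact: truncnS_gt.
set d := N.+1%:R^-1 : R.
have d0 : 0 < d by rewrite invr_gt0.
have nd : n.+1%:R * d <= e by rewrite ler_pdivrMr// mulrC -ler_pdivrMr// ltW.
pose m k := Num.truncn (v k / d).
pose b k := (m k).+1%:R / N.+1%:R : R.
have vb k : v k <= b k.
  by rewrite /b -ler_pdivrMr// ltW// truncnS_gt.
have bv k : b k - d <= v k.
  rewrite /b -/d -natr1 mulrDl mul1r addrK -ler_pdivlMr//.
  by rewrite /m truncn_le divr_ge0 ?v0 ?(ltW d0).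
have b0 k : 0 < b k by rewrite mulr_gt0.
set A := \sum_(k < n.+1) b k `^ p.
have A0 : 0 < A.
  rewrite /A big_ord_recl ltr_wpDr ?powR_gt0//.
  by apply: sumr_ge0 => k _; exact: powR_ge0.
have VA : V `^ p^-1 <= A `^ p^-1.
  apply: ge0_ler_powR; rewrite ?invr_ge0 ?nnegrE ?(ltW p0)// ?(ltW A0)//.
  by apply: ler_sum => k _; apply: ge0_ler_powR; rewrite ?nnegrE ?(ltW p0)// ltW.
apply: (le_trans VA).
have {H} := H b; move=> /(_ _)/wrap[]; first by exists N, m.
rewrite -/A => H; clearbody b d.
have [a [a0 ap ea eA]] := powR_root p1 A0.
rewrite ea; rewrite eA in H.
have ba k : b k `^ (p - 1) <= a `^ (p - 1).
  have ba' : b k <= a.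
    rewrite -ea -[leLHS](powRr1 (ltW (b0 k))) -(mulfV pn0) powRrM.
    apply: ge0_ler_powR; rewrite ?invr_ge0 ?nnegrE ?(ltW p0)// ?powR_ge0 ?(ltW A0)//.
    rewrite /A (bigD1 k)//= lerDl; apply: sumr_ge0 => i _; exact: powR_ge0.
  have p10 : 0 <= p - 1 by rewrite subr_ge0.
  exact: (ge0_ler_powR p10 (ltW (b0 k)) (ltW a0) ba').
have lo : A - n.+1%:R * d * a `^ (p - 1) <= \sum_(k < n.+1) b k `^ (p - 1) * v k.
  apply: (@le_trans _ _ (\sum_(k < n.+1) (b k `^ p - d * a `^ (p - 1)))).
    by rewrite sumrB sumr_const card_ord -mulrA mulr_natl.
  apply: ler_sum => k _.
  apply: (@le_trans _ _ (b k `^ (p - 1) * (b k - d))); last first.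
    by rewrite ler_wpM2l ?powR_ge0.
  rewrite mulrBr (mulrC _ (b k)) mulr_powRB1 ?(ltW (b0 k))// lerB// mulrC.
  by rewrite ler_pM2l.
have {lo} := le_trans lo H.
have -> : A = a `^ (p - 1) * a by rewrite -ap mulrC mulr_powRB1// ltW.
have c0 : 0 < a `^ (p - 1) by exact: powR_gt0.
move: (a `^ _) c0 => c c0; rewrite (mulrC _ c) -mulrBr (ler_pM2l c0) => h.
by rewrite -lerBlDr (le_trans _ h)// lerB.
Qed.

(** * Finite measures and geometric convergence *)

(** The weighted sum of the restrictions of [mu] to a countable cover by sets of
    finite measure. *)
Lemma finite_measure_of_sigma_finite (R : realType) (disp : measure_display)
    (X : measurableType disp) (mu : {sigma_finite_measure set X -> \bar R}) :
  exists nu : {measure set X -> \bar R}, (nu setT < +oo)%E /\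
    forall A, measurable A -> nu A = 0%E -> mu A = 0%E.
Proof.
have [F FT mF] := sigma_finiteT mu.
have mF1 n : measurable (F n) by have [] := mF n.
have fF n : mu (F n) \is a fin_num by rewrite ge0_fin_numE//; have [] := mF n.
pose k n : R := (2 ^ (n + 1))%:R^-1 / (1 + fine (mu (F n))).
have d0 n : 0 < 1 + fine (mu (F n)) by rewrite ltr_pwDl// fine_ge0.
have k0 n : 0 < k n by rewrite /k divr_gt0// invr_gt0 ltr0n expn_gt0.
pose nu := mseries (fun n => mscale (NngNum (ltW (k0 n))) (mrestr mu (mF1 n))) 0.
exists nu; split.
  have := @cvg_geometric_eseries_half R 1 0.
  move/cvg_lim => /(_ (@ereal_hausdorff _)) h.
  apply: (@le_lt_trans _ _ (1 / 2 ^+ 0)%:E); last exact: ltry.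
  rewrite -h; apply: lee_nneseries => [n _ _|n _]; first exact: measure_ge0.
  rewrite [leLHS](_ : _ = (k n)%:E * mu (setT `&` F n))%E//.
  rewrite setTI -(fineK (fF n)) -EFinM lee_fin /k div1r.
  rewrite -mulrA ler_piMr ?invr_ge0 ?ler0n//.
  by rewrite mulrC ler_pdivrMr// mul1r lerDr.
move=> A mA nuA.
have -> : A = \bigcup_n (A `&` F n) by rewrite -setI_bigcupr -FT setIT.
apply/eqP; rewrite eq_le measure_ge0 andbT.
apply: le_trans (measure_sigma_subadditive _ _ _ (@subset_refl _ _)) _ => //.
- by move=> n; exact: measurableI.
- by apply: bigcup_measurable => n _; exact: measurableI.
rewrite eseries0// => n _ _; apply/eqP.
have := @nneseries_lim_ge R (fun n => mscale (NngNum (ltW (k0 n))) (mrestr mu (mF1 n)) A)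
  xpredT 0 n.+1 (fun n _ _ => measure_ge0 _ _).
rewrite [leRHS](_ : _ = 0%E)// big_nat_recr//= => h.
have : (mscale (NngNum (ltW (k0 n))) (mrestr mu (mF1 n)) A <= 0)%E.
  apply: le_trans h; rewrite leeDr//; apply: sume_ge0 => i _; exact: measure_ge0.
rewrite [leLHS](_ : _ = (k n)%:E * mu (A `&` F n))%E// pmule_rle0 ?lte_fin// => h0.
by rewrite eq_le h0 measure_ge0.
Qed.

(** The series of the [4 ^+ n * D n] is integrable, hence finite almost everywhere,
    and bounds each of its terms. *)
Lemma ae_geometric_bound (R : realType) (disp : measure_display)
    (X : measurableType disp) (nu : {measure set X -> \bar R})
    (D : nat -> X -> R) (c : R) :
  (forall n, measurable_fun setT (D n)) -> (forall n x, 0 <= D n x) -> 0 <= c ->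
  (forall n, (\int[nu]_x (D n x)%:E <= (c / 8 ^+ n)%:E)%E) ->
  {ae nu, forall x, exists C, forall n, D n x <= C / 4 ^+ n}.
Proof.
move=> mD D0 c0 iD.
pose f n (x : X) : \bar R := (4 ^+ n * D n x)%:E.
have mf n : measurable_fun setT (f n).
  by apply/measurable_EFinP; apply: measurable_funM.
have f0 n x : setT x -> (0 <= f n x)%E by rewrite lee_fin mulr_ge0// exprn_ge0.
pose G (x : X) : \bar R := (\sum_(0 <= n <oo) f n x)%E.
have G0 x : (0 <= G x)%E by apply: nneseries_ge0 => n _ _; exact: f0.
have iG : nu.-integrable setT G.
  apply/integrableP; split.
    by apply: ge0_emeasurable_sum => // n x _ _; exact: f0.
  under eq_integral do rewrite gee0_abs//.
  rewrite integral_nneseries//.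
  have := @cvg_geometric_eseries_half R (2 * c) 0.
  move/cvg_lim => /(_ (@ereal_hausdorff _)) h.
  apply: (@le_lt_trans _ _ (2 * c / 2 ^+ 0)%:E); last exact: ltry.
  rewrite -h; apply: lee_nneseries => [n _ _|n _].
    by apply: integral_ge0 => x _; exact: f0.
  under eq_integral do rewrite /f EFinM.
  rewrite ge0_integralZl_EFin//; first last.
  - exact/measurable_EFinP.
  - by move=> x _; rewrite lee_fin.
  have h4 : (0 <= (4 ^+ n : R)%:E)%E by rewrite lee_fin exprn_ge0.
  apply: (le_trans (lee_wpmul2l h4 (iD n))).
  rewrite -EFinM lee_fin addn1 natrX exprS.
  have -> : (8 : R) = 4 * 2 by rewrite -natrM.
  rewrite exprMn le_eqVlt; apply/orP; left; apply/eqP; field.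
  by rewrite !expf_neq0 ?pnatr_eq0.
have := integrable_ae measurableT iG; apply: filterS => x /(_ Logic.I) Gfin.
exists (fine (G x)) => n.
rewrite ler_pdivlMr ?exprn_gt0// mulrC -lee_fin (fineK Gfin).
apply: le_trans (@nneseries_lim_ge _ _ xpredT 0 n.+1 (fun n _ _ => f0 n x Logic.I)).
by rewrite big_nat_recr//= leeDr//; apply: sume_ge0 => i _; exact: f0.
Qed.

Lemma cvg_of_geometric_dist (R : realType) (a : nat -> R) (C : R) :
  (forall n, `|a n - a n.+1| <= C / 2 ^+ n) -> cvgn a.
Proof.
move=> aC.
have : cvgn (series (fun n => a n.+1 - a n)).
  apply: normed_cvg; apply: (@series_le_cvg _ _ (geometric C 2^-1)) => //= n.
  - by have := le_trans (normr_ge0 _) (aC n); rewrite exprVn.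
  - by rewrite distrC (le_trans (aC n))// exprVn.
  by apply: is_cvg_geometric_series; rewrite ger0_norm ?invr_ge0// invf_lt1// ltr1n.
move=> /cvg_ex[l al]; apply/cvg_ex; exists (l + a 0%N).
have aE : a = (fun n => series (fun n => a n.+1 - a n) n + a 0%N).
  by apply/funext => n; rewrite /series/= telescope_sumr ?subrK.
rewrite [X in X @ _ --> _]aE.
exact: (cvgD al (cvg_cst (a 0%N))).
Qed.

Lemma cvg_geometric_close (R : realType) (a b : nat -> R) (C l : R) :
  (forall n, `|a n - b n| <= C / 2 ^+ n) -> a @ \oo --> l -> b @ \oo --> l.
Proof.
move=> ab al.
have e0 : (fun n => C / 2 ^+ n) @ \oo --> 0.
  have := @cvg_geometric R C 2^-1; rewrite ger0_norm ?invr_ge0// invf_lt1// ltr1n.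
  move=> /(_ isT); have -> // : geometric C 2^-1 = (fun n => C / 2 ^+ n).
  by apply/funext => n; rewrite /= exprVn.
have bE : b = (fun n => a n - (a n - b n)) by apply/funext => n; rewrite subKr.
rewrite [X in X @ _ --> _]bE -(subr0 l); apply: cvgB => //.
apply: norm_cvg0; apply: (squeeze_cvgr _ (cvg_cst 0) e0).
by apply: nearW => n; rewrite normr_ge0 ab.
Qed.

Lemma sqr_le_geometric (R : realType) (x C : R) n :
  x ^+ 2 <= C / 4 ^+ n -> `|x| <= (C + 1) / 2 ^+ n.
Proof.
move=> h; have C0 : 0 <= C.
  have := le_trans (sqr_ge0 _) h; rewrite pmulr_lge0// invr_gt0 exprn_gt0//.
rewrite -(@ler_pXn2r _ 2)// ?nnegrE ?divr_ge0 ?addr_ge0 ?exprn_ge0//.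
rewrite real_normK ?num_real// (le_trans h)// expr_div_n exprAC (_ : 2 ^+ 2 = 4) -?natrX//.
rewrite ler_pM2r ?invr_gt0 ?exprn_gt0//; nra.
Qed.

(** * Limits along directed families of midpoint convex sets *)

Section directed_midpoint_convex.
Context (R : realType) (disp : measure_display) (X : measurableType disp).
Variables (nu : {measure set X -> \bar R}) (d : nat).
Hypothesis nu_fin : (nu setT < +oo)%E.
Implicit Types phi psi : 'I_d -> X -> R.

Let E phi j x := expR (- (phi j x / 2)).
Let Q phi x := \sum_(j < d) (E phi j x) ^+ 2.
Let D phi psi x := \sum_(j < d) (E phi j x - E psi j x) ^+ 2.
Let mid phi psi j x := (phi j x + psi j x) / 2.
Let good phi := forall j, measurable_fun setT (phi j) /\ forall x, 0 <= phi j x.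
Let J phi := fine (\int[nu]_x (Q phi x)%:E).

Let measurable_E phi : good phi -> forall j, measurable_fun setT (E phi j).
Proof.
move=> gphi j; apply: measurableT_comp => //; apply: measurableT_comp => //.
by apply: measurable_funM => //; have [] := gphi j.
Qed.

Let E_ge0 phi j x : 0 <= E phi j x. Proof. exact: expR_ge0. Qed.

Let E_le1 phi : good phi -> forall j x, E phi j x <= 1.
Proof.
move=> gphi j x; rewrite -expR0 ler_expR oppr_le0 divr_ge0//.
by have [_] := gphi j.
Qed.

Let measurable_Q phi : good phi -> measurable_fun setT (Q phi).
Proof.
move=> gphi; apply: measurable_sum => j; apply: measurable_funX.
exact: measurable_E.
Qed.

Let measurable_D phi psi : good phi -> good psi -> measurable_fun setT (D phi psi).
Proof.
move=> gphi gpsi; apply: measurable_sum => j; apply: measurable_funX.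
by apply: measurable_funB; exact: measurable_E.
Qed.

Let D_ge0 phi psi x : 0 <= D phi psi x.
Proof. by apply: sumr_ge0 => j _; exact: sqr_ge0. Qed.

Let Q_ge0 phi x : 0 <= Q phi x.
Proof. by apply: sumr_ge0 => j _; exact: sqr_ge0. Qed.

Let intQ_le phi : good phi ->
  (\int[nu]_x (Q phi x)%:E <= (d%:R)%:E * nu setT)%E.
Proof.
move=> gphi; rewrite -integral_cst//; apply: ge0_le_integral => //.
- by move=> x _; rewrite lee_fin.
- by apply/measurable_EFinP; exact: measurable_Q.
move=> x _; rewrite lee_fin.
apply: (@le_trans _ _ (\sum_(j < d) 1)); last by rewrite sumr_const card_ord.
by apply: ler_sum => j _; rewrite expr_le1//; exact: E_le1.
Qed.

Let JE phi : good phi -> ((J phi)%:E = \int[nu]_x (Q phi x)%:E)%E.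
Proof.
move=> gphi; rewrite /J fineK// ge0_fin_numE; last first.
  by apply: integral_ge0 => x _; rewrite lee_fin.
by apply: (le_lt_trans (intQ_le gphi)); rewrite lte_mul_pinfty// lee_fin.
Qed.

Let J_ge0 phi : 0 <= J phi.
Proof. by apply/fine_ge0/integral_ge0 => x _; rewrite lee_fin. Qed.

Let good_mid phi psi : good phi -> good psi -> good (mid phi psi).
Proof.
move=> gphi gpsi j; have [m1 p1] := gphi j; have [m2 p2] := gpsi j; split.
  by apply: measurable_funM => //; exact: measurable_funD.
by move=> x; rewrite divr_ge0// addr_ge0.
Qed.

(** The square of the damped midpoint is the product of the damped ends, so that [J]
    is uniformly convex for the L^2 distance of the damped functions. *)
Let parallelogram phi psi : good phi -> good psi ->
  (\int[nu]_x (D phi psi x)%:E = (J phi + J psi - 2 * J (mid phi psi))%:E)%E.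
Proof.
move=> gphi gpsi; have gm := good_mid gphi gpsi.
have e : (\int[nu]_x (D phi psi x)%:E + 2%:E * (J (mid phi psi))%:E =
    (J phi)%:E + (J psi)%:E)%E.
  rewrite (JE gm) (JE gphi) (JE gpsi) -ge0_integralZl//; last 2 first.
  - by apply/measurable_EFinP; exact: measurable_Q.
  - by move=> x _; rewrite lee_fin.
  rewrite -!ge0_integralD//; first apply: eq_integral => x _.
  - rewrite -!EFinD; congr (_%:E).
    rewrite /D /Q mulr_sumr -!big_split/=; apply: eq_bigr => j _.
    have -> : E (mid phi psi) j x ^+ 2 = E phi j x * E psi j x.
      rewrite /E expr2 -!expRD /mid; congr expR; lra.
    ring.
  - by move=> x _; rewrite lee_fin.
  - by apply/measurable_EFinP; exact: measurable_Q.
  - by move=> x _; rewrite lee_fin.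
  - by apply/measurable_EFinP; exact: measurable_Q.
  - by move=> x _; rewrite lee_fin.
  - by apply/measurable_EFinP; exact: measurable_D.
  - by move=> x _; rewrite mule_ge0// lee_fin.
  - apply: emeasurable_funM => //; apply/measurable_EFinP; exact: measurable_Q.
move: e; move: (J (mid _ _)) (J phi) (J psi) (\int[nu]_x _)%E => Jm J1 J2 I.
case: I => [r| |]//.
rewrite -!EFinD => -[<-]; congr (_%:E); ring.
Qed.

(** A directed family of midpoint convex sets has a common limit point, in the
    coordinate [exp (- phi / 2)]. The infimum of [J] over [Phi i] increases along the
    family, up to some [S]. Along a chain [b] whose infima tend to [S] rapidly,
    near-minimisers are close to each other by [parallelogram], so they converge. For
    any index [i], near-minimisers taken below both [b n] and [i] are close to the
    former ones, so they have the same limit. *)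
Lemma directed_midpoint_convex_limit (I : Type) (i0 : I)
    (Phi : I -> set ('I_d -> X -> R)) :
  (forall i k, exists l, Phi l `<=` Phi i /\ Phi l `<=` Phi k) ->
  (forall i, Phi i !=set0) ->
  (forall i phi, Phi i phi ->
    forall j, measurable_fun setT (phi j) /\ forall x, 0 <= phi j x) ->
  (forall i phi psi, Phi i phi -> Phi i psi ->
    Phi i (fun j x => (phi j x + psi j x) / 2)) ->
  exists u : 'I_d -> X -> R,
    [/\ forall j, measurable_fun setT (u j), forall j x, 0 <= u j x <= 1 &
    forall i, exists phi : nat -> 'I_d -> X -> R, (forall n, Phi i (phi n)) /\
      {ae nu, forall x, forall j,
        expR (- (phi n j x / 2)) @[n --> \oo] --> u j x}].
Proof.
move=> Phi_dir Phi0 Phi_good Phi_mid.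
pose m i := inf [set J phi | phi in Phi i].
have has_m i : has_inf [set J phi | phi in Phi i].
  split; first by have [phi Pphi] := Phi0 i; exists (J phi); exists phi.
  by exists 0 => _ [phi _ <-].
have m_le i phi : Phi i phi -> m i <= J phi.
  by move=> Pphi; apply: ge_inf; [have [] := has_m i|exists phi].
have Jd phi : (exists i, Phi i phi) -> J phi <= d%:R * fine (nu setT).
  move=> [i /Phi_good gphi].
  by rewrite -lee_fin (JE gphi) EFinM fineK ?ge0_fin_numE//; exact: intQ_le.
have has_S : has_sup (range m).
  split; first by exists (m i0); exists i0.
  exists (d%:R * fine (nu setT)) => _ [i _ <-].
  have [phi Pphi] := Phi0 i; apply: le_trans (m_le _ _ Pphi) (Jd _ _).
  by exists i.
set S := sup (range m).
have m_S i : m i <= S by apply: ub_le_sup; [have [] := has_S|exists i].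
have near_inf i e : 0 < e -> exists2 phi, Phi i phi & J phi < S + e.
  move=> e0; have [_ [phi Pphi <-] h] := inf_adherent e0 (has_m i).
  by exists phi => //; apply: (lt_le_trans h); rewrite lerD2r; exact: m_S.
have near_sup e : 0 < e -> exists i, forall phi, Phi i phi -> S - e < J phi.
  move=> e0; have [_ [i _ <-] h] := sup_adherent e0 has_S.
  by exists i => phi Pphi; apply: (lt_le_trans h); exact: m_le.
pose e n : R := (8 ^+ n)^-1.
have e0 n : 0 < e n by rewrite invr_gt0 exprn_gt0.
have [a aP] := choice (fun n => near_sup _ (e0 n)).
have [meet meetP] := choice (fun ik : I * I => Phi_dir ik.1 ik.2).
pose b := fix b n := if n is n'.+1 then meet (b n', a n'.+1) else a 0%N.
have bS n : Phi (b n.+1) `<=` Phi (b n) by have [] := meetP (b n, a n.+1).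
have bP n phi : Phi (b n) phi -> S - e n < J phi.
  case: n => [|n]; first exact: aP.
  by move=> ?; apply: aP; have [_] := meetP (b n, a n.+1); apply.
have close n phi psi : Phi (b n) phi -> Phi (b n) psi ->
    J phi < S + e n -> J psi < S + e n ->
    (\int[nu]_x (D phi psi x)%:E <= (4 / 8 ^+ n)%:E)%E.
  move=> Pphi Ppsi h1 h2; rewrite parallelogram; [|exact: Phi_good Pphi|exact: Phi_good Ppsi].
  have := bP n _ (Phi_mid _ _ _ Pphi Ppsi).
  rewrite lee_fin -/(mid phi psi) -[4 / _]/(4 * e n).
  move: (J _) (J phi) (J psi) (e n) h1 h2 => Jm J1 J2 en h1 h2; lra.
have hf n : exists phi, Phi (b n) phi /\ J phi < S + e n.
  by have [phi ? ?] := near_inf (b n) _ (e0 n); exists phi.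
have [f fP] := choice hf.
have gf n : good (f n) by have [/Phi_good] := fP n.
have DE phi psi j x : (E phi j x - E psi j x) ^+ 2 <= D phi psi x.
  by rewrite /D (bigD1 j)//= lerDl; apply: sumr_ge0 => k _; exact: sqr_ge0.
have f_cvg : {ae nu, forall x, forall j, cvgn (fun n => E (f n) j x)}.
  have ff n : (\int[nu]_x (D (f n) (f n.+1) x)%:E <= (4 / 8 ^+ n)%:E)%E.
    have [Pn Jn] := fP n; have [Pn1 Jn1] := fP n.+1.
    apply: (close n _ _ Pn (bS _ _ Pn1) Jn).
    apply: (lt_le_trans Jn1); rewrite lerD2l /e lef_pV2 ?posrE ?exprn_gt0//.
    by rewrite exprS ler_peMl ?exprn_ge0// ler1n.
  have := ae_geometric_bound (fun n => measurable_D (gf n) (gf n.+1))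
    (fun n x => D_ge0 _ _ _) (ler0n R 4) ff.
  apply: filterS => x [C CP] j; apply: (@cvg_of_geometric_dist _ _ (C + 1)) => n.
  exact/sqr_le_geometric/(le_trans (DE _ _ _ _)).
pose u j x := fine (limn_esup (fun n => (E (f n) j x)%:E)).
have u_cvg : {ae nu, forall x, forall j, E (f n) j x @[n --> \oo] --> u j x}.
  apply: filterS f_cvg => x h j; have /cvg_ex[l hl] := h j.
  have hl' : (E (f n) j x)%:E @[n --> \oo] --> l%:E by apply: cvg_EFin => //; exact: nearW.
  rewrite /u is_cvg_limn_esupE; last by apply/cvg_ex; exists l%:E.
  by rewrite (cvg_lim (@ereal_hausdorff _) hl').
exists u; split.
- move=> j; apply: measurableT_comp => //.
  apply: measurable_fun_limn_esup => n; apply/measurable_EFinP; exact: measurable_E.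
- move=> j x; rewrite /u limn_esup_lim; set v := esups _.
  have v01 n : (0 <= v n <= 1)%E.
    apply/andP; split.
      apply: (@le_trans _ _ (E (f n) j x)%:E); first by rewrite lee_fin.
      by apply: ereal_sup_ubound; exists n => /=.
    by apply: ge_ereal_sup => _ [k _ <-]; rewrite lee_fin E_le1.
  have l0 : (0 <= limn v)%E.
    apply: lime_ge; first exact: is_cvg_esups.
    by apply: nearW => n; have /andP[] := v01 n.
  have l1 : (limn v <= 1)%E.
    apply: lime_le; first exact: is_cvg_esups.
    by apply: nearW => n; have /andP[] := v01 n.
  by case: (limn v) l0 l1 => [r| |]//=; rewrite !lee_fin => -> ->.
move=> i.
have [c cP] := choice (fun n => Phi_dir (b n) i).
have hg n : exists phi, Phi (c n) phi /\ J phi < S + e n.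
  by have [phi ? ?] := near_inf (c n) _ (e0 n); exists phi.
have [g gP] := choice hg.
have gg n : good (g n) by have [/Phi_good] := gP n.
exists g; split; first by move=> n; apply: (proj2 (cP n)); have [] := gP n.
have fg n : (\int[nu]_x (D (f n) (g n) x)%:E <= (4 / 8 ^+ n)%:E)%E.
  have [Pn Jn] := fP n; have [Pg Jg] := gP n.
  exact: (close n _ _ Pn (proj1 (cP n) _ Pg) Jn Jg).
have := ae_geometric_bound (fun n => measurable_D (gf n) (gg n))
  (fun n x => D_ge0 _ _ _) (ler0n R 4) fg.
apply: filterS2 u_cvg => x hu [C CP] j.
apply: (@cvg_geometric_close _ _ _ (C + 1) _ _ (hu j)) => n.
exact/sqr_le_geometric/(le_trans (DE _ _ _ _)).
Qed.

End directed_midpoint_convex.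

(** * Weights from approximate maximisers *)

Lemma prod_powR_exponents (R : realType) (I : finType) (x : R) (theta : I -> R) :
  0 < x -> \prod_j x `^ (theta j) = x `^ (\sum_j theta j).
Proof.
move=> x0; symmetry; apply: (big_morph (fun t => x `^ t)); last exact: powRr0.
by move=> a b; rewrite powRD// (gt_eqF x0) implybT.
Qed.

Lemma ge0_prod_powR (R : realType) (I : finType) (a theta : I -> R) :
  0 <= \prod_j a j `^ theta j.
Proof. by apply: prodr_ge0 => j _; exact: powR_ge0. Qed.

Lemma measurable_prod_powR (R : realType) (disp : measure_display)
    (X : measurableType disp) (d : nat) (theta : 'I_d -> R) (g : 'I_d -> X -> R) :
  (forall j, measurable_fun setT (g j)) ->
  measurable_fun setT (fun x => \prod_(j < d) g j x `^ theta j).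
Proof.
move=> mg; apply: measurable_prod => j _.
by apply: (measurableT_comp (measurable_powR _)).
Qed.

(** The increment of a geometric mean when one factor [p] moves to
    [(1 - t) * p + t * q], with a quadratic error thanks to [q <= K * p]; where
    [p = 0] this bound also forces [q = 0]. *)
Lemma geometric_mean_increment (R : realType) (theta t K p q w : R) :
  0 < theta <= 1 -> 0 < t <= 2^-1 -> 1 <= K ->
  0 <= p -> 0 <= q -> q <= K * p -> 0 <= w ->
  p `^ theta * w + theta * t * (q * (p `^ theta * w / p)) <=
  ((1 - t) * p + t * q) `^ theta * w +
  (theta * t + 2 * (t * K) ^+ 2) * (p `^ theta * w).
Proof.
move=> /andP[th0 th1] /andP[t0 t1] K1 p0 q0 qK w0.
have C0 : 0 <= theta * t + 2 * (t * K) ^+ 2.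
  by apply: addr_ge0; apply: mulr_ge0; rewrite ?sqr_ge0 ?ler0n ?(ltW th0) ?(ltW t0).
have P0 : 0 <= p `^ theta * w by rewrite mulr_ge0 ?powR_ge0.
have [pz|pnz] := eqVneq p 0.
  have -> : q = 0 by apply/le_anti; rewrite q0 andbT -(mulr0 K) -pz.
  rewrite mul0r mulr0 addr0 {1}pz powR0 ?gt_eqF// mul0r.
  by rewrite addr_ge0 ?mulr_ge0 ?powR_ge0.
have {pnz}p0 : 0 < p by rewrite lt_neqAle eq_sym pnz.
set P := p `^ theta * w in P0 *.
have -> : q * (P / p) = P * (q / p) by rewrite mulrCA.
have r0 : 0 <= q / p by rewrite divr_ge0// ltW.
have rK : q / p <= K by rewrite ler_pdivrMr.
have -> : (1 - t) * p + t * q = p * (1 + t * (q / p - 1)) by field; rewrite gt_eqF.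
move: (q / p) r0 rK => r r0 rK; pose s := t * (r - 1); rewrite -/s.
have s1 : - 2^-1 <= s by rewrite /s; nra.
have s2 : s ^+ 2 <= (t * K) ^+ 2.
  rewrite -subr_ge0 subr_sqr mulr_ge0//.
    have -> : t * K - s = t * (K - r + 1) by rewrite /s; ring.
    apply: mulr_ge0; first exact: ltW. lra.
  have -> : t * K + s = t * (K - 1 + r) by rewrite /s; ring.
  apply: mulr_ge0; first exact: ltW. lra.
have s3 : 0 <= 1 + s by lra.
have -> : (p * (1 + s)) `^ theta * w = P * (1 + s) `^ theta.
  by rewrite (powRM _ (ltW p0) s3) mulrAC.
have H : P * (1 + theta * s - 2 * s ^+ 2) <= P * (1 + s) `^ theta.
  by apply: ler_wpM2l => //; exact: powR_ge_second_order.
apply: (@le_trans _ _ (P * (1 + theta * s - 2 * s ^+ 2) +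
  (theta * t + 2 * (t * K) ^+ 2) * P)); last first.
  by rewrite lerD2r.
rewrite -subr_ge0.
have -> : P * (1 + theta * s - 2 * s ^+ 2) + (theta * t + 2 * (t * K) ^+ 2) * P -
    (P + theta * t * (P * r)) = 2 * P * ((t * K) ^+ 2 - s ^+ 2) by rewrite /s; ring.
by apply: mulr_ge0; [rewrite mulr_ge0|rewrite subr_ge0].
Qed.

Lemma ge0_integral_axpy (R : realType) (disp : measure_display)
    (X : measurableType disp) (mu : {measure set X -> \bar R}) (a : R)
    (f g : X -> R) :
  measurable_fun setT f -> measurable_fun setT g -> (forall x, 0 <= f x) ->
  (forall x, 0 <= g x) -> 0 <= a ->
  (\int[mu]_x (f x + a * g x)%:E =
   \int[mu]_x (f x)%:E + a%:E * \int[mu]_x (g x)%:E)%E.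
Proof.
move=> mf mg f0 g0 a0; under eq_integral do rewrite EFinD EFinM.
rewrite ge0_integralD//.
- rewrite ge0_integralZl_EFin//; first by move=> x _; rewrite lee_fin.
  exact/measurable_EFinP.
- by move=> x _; rewrite lee_fin.
- exact/measurable_EFinP.
- by move=> x _; rewrite mule_ge0 ?lee_fin.
- by apply/measurable_EFinP/measurable_funM.
Qed.

(** Divides the first-order inequality at a [t ^+ 2]-maximiser by [theta * t]; the
    errors are all of order [t]. *)
Lemma near_maximizer_slope (R : realType) (theta t K F F' I : R) :
  0 < theta -> 0 < t -> F' < F + t ^+ 2 ->
  F + theta * t * I <= F' + (theta * t + 2 * (t * K) ^+ 2) * F ->
  I <= F + t * ((1 + 2 * K ^+ 2 * F) / theta).
Proof.
move=> th0 t0 hF h.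
have {}h : t * (theta * I) < t * (t * (1 + 2 * K ^+ 2 * F) + theta * F).
  have := le_lt_trans h (ltr_leD hF (lexx _)).
  have -> : t * (t * (1 + 2 * K ^+ 2 * F) + theta * F) =
    t ^+ 2 + (theta * t + 2 * (t * K) ^+ 2) * F by ring.
  by rewrite -addrA ltrD2l mulrA (mulrC theta t).
move: h; rewrite ltr_pM2l// => /ltW h.
rewrite -(ler_pM2l th0) (le_trans h)// le_eqVlt; apply/orP; left; apply/eqP.
by field; rewrite gt_eqF.
Qed.

(** At a maximiser [g] of the concave functional [g |-> \int \prod_j g_j ^ theta_j],
    moving [g_j] towards [h] does not increase it, and the first-order condition is
    [\int h * phi_j <= \int \prod_i g_i ^ theta_i <= B] for the weights
    [phi_j = (\prod_i g_i ^ theta_i) / g_j], whose own geometric mean is [1].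
    A near-maximiser suffices when the members of each [G j] are comparable. *)
Lemma near_maximizer_weights (R : realType) (disp : measure_display)
    (X : measurableType disp) (mu : {measure set X -> \bar R}) (d : nat)
    (theta : 'I_d -> R) (G : 'I_d -> set (X -> R)) (K B eta : R) :
  (forall j, 0 < theta j) -> \sum_(j < d) theta j = 1 ->
  (forall j, G j !=set0) ->
  (forall j g, G j g -> measurable_fun setT g /\ forall x, 0 <= g x) ->
  (forall j g h (t : R), G j g -> G j h -> 0 <= t <= 1 ->
    G j (fun x => (1 - t) * g x + t * h x)) ->
  1 <= K -> (forall j g h, G j g -> G j h -> forall x, h x <= K * g x) ->
  (forall g : 'I_d -> X -> R, (forall j, G j (g j)) ->
    (\int[mu]_x (\prod_(j < d) g j x `^ theta j)%:E <= B%:E)%E) ->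
  0 < eta ->
  exists phi : 'I_d -> X -> R,
    [/\ forall j, measurable_fun setT (phi j) /\ forall x, 0 <= phi j x,
        forall x, (forall j g, G j g -> 0 < g x) ->
          1 <= \prod_(j < d) phi j x `^ theta j &
        forall j h, G j h -> (\int[mu]_x (h x * phi j x)%:E <= (B + eta)%:E)%E].
Proof.
move=> th0 th1 G0 G_good G_conv K1 G_cmp G_bound eta0.
pose P (g : 'I_d -> X -> R) x := \prod_(j < d) g j x `^ theta j.
pose F g := fine (\int[mu]_x (P g x)%:E).
have mP g : (forall j, G j (g j)) -> measurable_fun setT (P g).
  by move=> Gg; apply: measurable_prod_powR => j; have [] := G_good _ _ (Gg j).
have FE g : (forall j, G j (g j)) -> (F g)%:E = (\int[mu]_x (P g x)%:E)%E.
  move=> Gg; rewrite /F fineK// ge0_fin_numE.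
    exact: le_lt_trans (G_bound _ Gg) (ltry _).
  by apply: integral_ge0 => x _; rewrite lee_fin ge0_prod_powR.
have F0 g : 0 <= F g.
  by apply/fine_ge0/integral_ge0 => x _; rewrite lee_fin ge0_prod_powR.
have FB g : (forall j, G j (g j)) -> F g <= B.
  by move=> Gg; rewrite -lee_fin FE//; exact: G_bound.
clearbody F.
have [g0 Gg0] := choice G0.
have B0 : 0 <= B := le_trans (F0 g0) (FB _ Gg0).
pose A := \sum_(j < d) (theta j)^-1.
have A_ge j : (theta j)^-1 <= A.
  by rewrite /A (bigD1 j)//= lerDl; apply: sumr_ge0 => i _; rewrite invr_ge0 ltW.
have th_le1 j : theta j <= 1.
  by rewrite -th1 (bigD1 j)//= lerDl; apply: sumr_ge0 => i _; rewrite ltW.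
have A0 : 0 <= A by apply: sumr_ge0 => i _; rewrite invr_ge0 ltW.
pose c := 1 + (1 + 2 * K ^+ 2 * B) * A.
have c0 : 0 < c.
  by rewrite ltr_pwDl// mulr_ge0// addr_ge0// mulr_ge0// mulr_ge0// sqr_ge0.
(* The step [t] makes the error [t * (1 + 2 * K ^+ 2 * B) / theta j] at most [eta]
   for all [j] at once, [A] being an upper bound of the [(theta j)^-1]. *)
pose t := Num.min 2^-1 (eta / c).
have t0 : 0 < t by rewrite lt_min invr_gt0 ltr0n divr_gt0.
have t_half : t <= 2^-1 by rewrite ge_min lexx.
have tc : t * c <= eta by rewrite -ler_pdivlMr// ge_min lexx orbT.
pose W := [set F g | g in [set g | forall j, G j (g j)]].
have supW : has_sup W.
  split; first by exists (F g0); exists g0.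
  by exists B => _ [g Gg <-]; exact: FB.
have [_ [g Gg <-] Fg] := sup_adherent (exprn_gt0 2 t0) supW.
have mg j : measurable_fun setT (g j) by have [] := G_good _ _ (Gg j).
have g_ge0 j x : 0 <= g j x by have [_] := G_good _ _ (Gg j).
pose phi j x := P g x / g j x.
have mphi j : measurable_fun setT (phi j).
  have -> : phi j = fun x => P g x * g j x `^ (-1).
    by apply/funext => x; rewrite powR_inv1.
  apply: measurable_funM; first exact: mP.
  exact: (measurableT_comp (measurable_powR _) (mg j)).
exists phi; split.
- move=> j; split=> // x; by rewrite divr_ge0// ge0_prod_powR.
- move=> x gx; have {}gx j : 0 < g j x by exact: gx (Gg j).
  have Px : 0 < P g x by apply: prodr_gt0 => j _; exact: powR_gt0.
  under eq_bigr => j _ do rewrite (ge0_powR_div _ (ltW Px) (g_ge0 j x)).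
  by rewrite prodf_div prod_powR_exponents// th1 powRr1 ?(ltW Px)// divff// gt_eqF.
move=> j h Gh; have [mh h0] := G_good _ _ Gh.
pose g' i := if i == j then (fun x => (1 - t) * g j x + t * h x) else g i.
have Gg' i : G i (g' i).
  rewrite /g'; case: eqP => [->|//]; apply: G_conv => //.
  by rewrite (ltW t0) (le_trans t_half)// invf_le1// ler1n.
have Fg' : F g' <= sup W by apply: ub_le_sup; [have [] := supW|exists g'].
pose C := theta j * t + 2 * (t * K) ^+ 2.
have C0 : 0 <= C.
  by apply: addr_ge0; apply: mulr_ge0; rewrite ?sqr_ge0 ?ler0n ?(ltW (th0 j)) ?(ltW t0).
have pointwise x : P g x + theta j * t * (h x * phi j x) <= P g' x + C * P g x.
  rewrite /phi /P (bigD1 j)//= [in X in _ <= X + _](bigD1 j)//= {1}/g' eqxx.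
  have -> : \prod_(i < d | i != j) g' i x `^ theta i =
            \prod_(i < d | i != j) g i x `^ theta i.
    by apply: eq_bigr => i /negPf ij; rewrite /g' ij.
  apply: geometric_mean_increment => //.
  - by rewrite th0 th_le1.
  - by rewrite t0.
  - exact: G_cmp.
  - by apply: prodr_ge0 => i _; exact: powR_ge0.
have hphi0 x : 0 <= h x * phi j x by rewrite mulr_ge0// divr_ge0// ge0_prod_powR.
have Pg0 g1 x : 0 <= P g1 x by exact: ge0_prod_powR.
have mhphi : measurable_fun setT (fun x => h x * phi j x) by exact: measurable_funM.
have mPg := mP _ Gg; have mPg' := mP _ Gg'.
have ineq : ((F g)%:E + (theta j * t)%:E * \int[mu]_x (h x * phi j x)%:E <=
    (F g')%:E + C%:E * (F g)%:E)%E.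
  have thjt0 : 0 <= theta j * t by rewrite mulr_ge0// ltW.
  have e1 := ge0_integral_axpy mu mPg mhphi (Pg0 g) hphi0 thjt0.
  have e2 := ge0_integral_axpy mu mPg' mPg (Pg0 g') (Pg0 g) C0.
  rewrite (FE _ Gg) (FE _ Gg') -e1 -e2 {e1 e2}; apply: ge0_le_integral => //.
  - by move=> x _; rewrite lee_fin addr_ge0// mulr_ge0.
  - by apply/measurable_EFinP/measurable_funD => //; exact: measurable_funM.
  - by apply/measurable_EFinP/measurable_funD => //; exact: measurable_funM.
  by move=> x _; rewrite lee_fin.
have FgB : F g <= B := FB _ Gg.
have {}Fg : F g' < F g + t ^+ 2 by rewrite (le_lt_trans Fg')// -ltrBlDr.
have : (0 <= \int[mu]_x (h x * phi j x)%:E)%E.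
  by apply: integral_ge0 => x _; rewrite lee_fin.
move: ineq; move: (\int[mu]_x _)%E => [I| |//]; last first.
  by rewrite gt0_muley ?lte_fin ?mulr_gt0.
have := F0 g; move: (F g) (F g') FgB Fg => Fg1 Fg2 FgB Fg Fg1_ge0.
rewrite -!EFinM -!EFinD !lee_fin => ineq I0.
apply: (le_trans (near_maximizer_slope (th0 j) t0 Fg ineq)).
apply: lerD => //; apply: le_trans tc; rewrite ler_pM2l// /c.
have u0 : 0 <= 1 + 2 * K ^+ 2 * Fg1.
  by apply: addr_ge0 => //; apply: mulr_ge0 => //; apply: mulr_ge0 => //; exact: sqr_ge0.
apply: (@le_trans _ _ ((1 + 2 * K ^+ 2 * Fg1) * A)); first by rewrite ler_wpM2l.
apply: (@le_trans _ _ ((1 + 2 * K ^+ 2 * B) * A)); last by rewrite lerDr.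
apply: ler_wpM2r => //; rewrite lerD2l; apply: ler_wpM2l => //.
by apply: mulr_ge0 => //; exact: sqr_ge0.
Qed.

(** * Passage to the limit *)

Lemma cvg_powR_ge0 (R : realType) (t : R) (a : nat -> R) (l : R) :
  0 < t -> (forall n, 0 <= a n) -> a @ \oo --> l ->
  (fun n => a n `^ t) @ \oo --> l `^ t.
Proof.
move=> t0 a0 al.
have : 0 <= l.
  rewrite -(cvg_lim (@Rhausdorff R) al); apply: limr_ge; first by apply/cvg_ex; exists l.
  exact: nearW.
rewrite le_eqVlt => /predU1P[l0|l0].
  rewrite -l0 powR0 ?gt_eqF//; apply/cvgrPdist_lt => e e0.
  have e0' : 0 < e `^ t^-1 by exact: powR_gt0.
  move: al; rewrite -l0 => /cvgrPdist_lt/(_ _ e0'); apply: filterS => n.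
  rewrite !sub0r !normrN !ger0_norm ?powR_ge0// => h.
  rewrite [ltRHS](_ : e = (e `^ t^-1) `^ t); last first.
    by rewrite -powRrM mulVf ?gt_eqF// powRr1// ltW.
  by apply: gt0_ltr_powR; rewrite ?nnegrE// ltW.
have c : {for l, continuous (fun x : R => x `^ t)}; last exact: (cvg_comp _ _ al c).
apply/differentiable_continuous/derivable1_diffP.
by apply: derivable_powR; rewrite in_itv/= l0.
Qed.

Lemma cvg_prod_real (R : realType) (I : finType) (a : nat -> I -> R) (l : I -> R) :
  (forall i, (fun n => a n i) @ \oo --> l i) ->
  (fun n => \prod_i a n i) @ \oo --> \prod_i l i.
Proof.
move=> al; elim: (index_enum I) => [|i s IH].
  rewrite big_nil; under eq_fun do rewrite big_nil; exact: cvg_cst.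
by rewrite big_cons; under eq_fun do rewrite big_cons; apply: cvgM.
Qed.

(** The inverse of [phi |-> exp (- phi / 2)] on [[0, +oo]]: a limit [0] of the damped
    functions means that the functions tend to [+oo]. *)
Definition undamp (R : realType) (u : R) : \bar R :=
  if u == 0 then +oo%E else (- 2 * ln u)%:E.

(** The product [0 * +oo = 0] is the right limit where [c = 0]. *)
Lemma cvg_undamp (R : realType) (a : nat -> R) (u c : R) :
  0 <= u -> 0 <= c -> (fun n => expR (- (a n / 2))) @ \oo --> u ->
  (fun n => (c * a n)%:E) @ \oo --> (c%:E * undamp u)%E.
Proof.
move=> u0 c0 au; rewrite /undamp; case: eqP => [uz|/eqP unz].
  move: c0; rewrite le_eqVlt => /predU1P[<-|c0].
    by rewrite mul0e; under eq_fun do rewrite mul0r; exact: cvg_cst.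
  rewrite gt0_muley ?lte_fin//; apply/cvgeyPge => A.
  move: au; rewrite uz => /cvgrPdist_lt/(_ _ (expR_gt0 (- (A / c / 2)))).
  apply: filterS => n; rewrite sub0r normrN gtr0_norm ?expR_gt0// ltr_expR ltrN2.
  by rewrite ltr_pM2r ?invr_gt0// ltr_pdivrMr// lee_fin mulrC => /ltW.
have {unz}u0 : 0 < u by rewrite lt_neqAle eq_sym unz.
rewrite -EFinM; apply: cvg_EFin; first exact: nearW.
apply: cvgMr => //=.
have aE : a = (fun n => - 2 * ln (expR (- (a n / 2)))).
  by apply/funext => n; rewrite expRK mulrNN mulrC divfK.
rewrite [X in X @ _ --> _]aE; apply: cvgMr.
exact: (cvg_comp _ _ au (continuous_ln u0)).
Qed.

Lemma ae_fatou_le (R : realType) (disp : measure_display)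
    (X : measurableType disp) (mu : {measure set X -> \bar R})
    (f : nat -> X -> R) (g : X -> \bar R) (C : \bar R) :
  (forall n, measurable_fun setT (f n)) -> (forall n x, 0 <= f n x) ->
  measurable_fun setT g -> (forall x, (0 <= g x)%E) ->
  {ae mu, forall x, (fun n => (f n x)%:E) @ \oo --> g x} ->
  (forall n, (\int[mu]_x (f n x)%:E <= C)%E) ->
  (\int[mu]_x g x <= C)%E.
Proof.
move=> mf f0 mg g0 fg fC.
have mf' n : measurable_fun setT (EFin \o f n) by exact/measurable_EFinP.
have f0' n x : setT x -> (0 <= (EFin \o f n) x)%E by rewrite lee_fin.
apply: (@le_trans _ _ (\int[mu]_x limn_einf (fun n => (f n x)%:E))%E).
  rewrite le_eqVlt; apply/orP; left; apply/eqP.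
  apply: ge0_ae_eq_integral => //.
  - have -> : (fun x => limn_einf (fun n => (f n x)%:E)) =
        (fun x => - limn_esup (-%E \o (fun n => (f n x)%:E)))%E.
      by apply/funext => x; rewrite limn_esupN oppeK.
    apply: measurableT_comp => //; apply: measurable_fun_limn_esup => n.
    by apply: measurableT_comp => //; exact: mf'.
  - move=> x _; rewrite limn_einf_lim; apply: lime_ge; first exact: is_cvg_einfs.
    by apply: nearW => n; apply: le_ereal_inf_tmp => _ [k _ <-]; rewrite lee_fin.
  apply: filterS fg => x fgx _.
  by rewrite is_cvg_limn_einfE ?(cvg_lim _ fgx)//; apply/cvg_ex; exists (g x).
apply: (le_trans (fatou mu measurableT mf' f0')).
rewrite limn_einf_lim; apply: lime_le; first exact: is_cvg_einfs.
apply: nearW => n; apply: le_trans (fC n).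
by apply: ereal_inf_lbound; exists n => /=.
Qed.

Lemma measure0_of_ae_not (R : realType) (disp : measure_display)
    (X : measurableType disp) (mu : {measure set X -> \bar R}) (A : set X) :
  measurable A -> {ae mu, forall x, ~ A x} -> mu A = 0%E.
Proof.
move=> mA [N [mN N0 AN]]; apply/eqP; rewrite eq_le measure_ge0 andbT -N0.
apply: le_measure; rewrite ?inE// => x Ax; by apply: AN; apply.
Qed.

(** * Disentangling convex sets of functions *)

Section weights.
Context (R : realType) (disp : measure_display) (X : measurableType disp).
Variables (mu : {sigma_finite_measure set X -> \bar R}) (d : nat).
Variables (theta : 'I_d -> R) (G : 'I_d -> set (X -> R)) (B : R).
Hypothesis theta_gt0 : forall j, 0 < theta j.
Hypothesis theta_sum : \sum_(j < d) theta j = 1.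
Hypothesis G_neq0 : forall j, G j !=set0.
Hypothesis G_good : forall j g, G j g ->
  measurable_fun setT g /\ forall x, 0 <= g x.
Hypothesis G_convex : forall j g h (t : R), G j g -> G j h -> 0 <= t <= 1 ->
  G j (fun x => (1 - t) * g x + t * h x).
Hypothesis G_saturates : forall j E, measurable E -> (0 < mu E)%E ->
  exists E' g, [/\ measurable E', E' `<=` E, (0 < mu E')%E, G j g &
    {ae mu, forall x, E' x -> 0 < g x}].
Hypothesis G_bound : forall g : 'I_d -> X -> R, (forall j, G j (g j)) ->
  (\int[mu]_x (\prod_(j < d) g j x `^ theta j)%:E <= B%:E)%E.

Let sel := {a : 'I_d -> X -> R | forall j, G j (a j)}.

(** One index [n] governs both the error and the size of the members tested against:
    [near_maximizer_weights] makes these sets nonempty, the average of two selections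
    makes them a directed family, and every member of [G j] is eventually tested. *)
Let Phi (i : sel * nat) : set ('I_d -> X -> R) :=
  [set phi : 'I_d -> X -> R | [/\ forall j, measurable_fun setT (phi j) /\ forall x, 0 <= phi j x,
    forall x, (forall j, 0 < sval i.1 j x) ->
      1 <= \prod_(j < d) phi j x `^ theta j &
    forall j g, G j g -> (forall x, g x <= i.2.+1%:R * sval i.1 j x) ->
      (\int[mu]_x (g x * phi j x)%:E <= (B + i.2.+1%:R^-1)%:E)%E]].

Let B_ge0 : 0 <= B.
Proof.
have [g Gg] := choice G_neq0; rewrite -lee_fin; apply: le_trans (G_bound Gg).
by apply: integral_ge0 => x _; rewrite lee_fin ge0_prod_powR.
Qed.

Let Phi_neq0 i : Phi i !=set0.
Proof.
case: i => -[a Ga] n; pose N : R := n.+1%:R.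
have N1 : 1 <= N by rewrite ler1n.
have N0 : 0 < N by rewrite ltr0n.
have B1 : 1 <= B + 1 by rewrite lerDr.
have B10 : 0 < B + 1 by exact: lt_le_trans B1.
(* The shift [c] towards [a] makes the members of [H j] comparable, and is so small
   that undoing it keeps the bound below [B + N^-1]. *)
pose c := (2 * N * (B + 1))^-1.
have c0 : 0 < c by rewrite invr_gt0 !mulr_gt0.
have c1 : c <= 2^-1.
  rewrite /c lef_pV2 ?posrE ?mulr_gt0// -[leLHS]mulr1 -mulrA ler_pM2l//.
  by rewrite mulr_ege1.
have c1' : 0 < 1 - c by lra.
have a0 j x : 0 <= a j x by have [_] := G_good (Ga j).
pose H j := [set h : X -> R | exists g : X -> R, [/\ G j g, forall x, g x <= N * a j x &
  h = fun x => (1 - c) * g x + c * a j x]].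
have HG j h : H j h -> G j h.
  by move=> [g [Gg _ ->]]; apply: G_convex => //; rewrite (ltW c0) (le_trans c1)// invf_le1// ler1n.
have Ha j h : H j h -> forall x, c * a j x <= h x.
  move=> [g [Gg _ ->]] x; rewrite lerDr mulr_ge0// ?(ltW c1')//.
  by have [_] := G_good Gg.
have HN j h : H j h -> forall x, h x <= N * a j x.
  move=> [g [Gg gN ->]] x; apply: (@le_trans _ _ ((1 - c) * (N * a j x) + c * (N * a j x))).
    apply: lerD; first by rewrite ler_pM2l.
    by rewrite ler_pM2l// ler_peMl.
  by rewrite -mulrDl subrK mul1r.
have [] := @near_maximizer_weights R disp X mu d theta H (N / c) B (2 * N)^-1 theta_gt0 theta_sum.
- by move=> j; exists (fun x => (1 - c) * a j x + c * a j x); exists (a j); split => // x; rewrite ler_peMl.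
- by move=> j h /HG; exact: G_good.
- move=> j g h t [g1 [Gg1 g1N ->]] [h1 [Gh1 h1N ->]] t01.
  exists (fun x => (1 - t) * g1 x + t * h1 x); split; first exact: G_convex.
    move=> x; have /andP[t0 t1] := t01.
    have t1' : 0 <= 1 - t by rewrite subr_ge0.
    apply: le_trans (lerD (ler_wpM2l t1' (g1N x)) (ler_wpM2l t0 (h1N x))) _.
    by rewrite -mulrDl subrK mul1r.
  by apply/funext => x; ring.
- by rewrite ler_pdivlMr// mul1r (le_trans c1)// (le_trans _ N1)// invf_le1// ler1n.
- move=> j g h Hg Hh x; apply: (le_trans (HN _ _ Hh x)).
  rewrite -mulrA ler_pM2l// mulrC ler_pdivlMr// mulrC; exact: Ha Hg x.
- by move=> g Hg; apply: G_bound => j; exact: HG.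
- by rewrite invr_gt0 mulr_gt0.
move=> phi [gphi phi1 phiH]; exists phi; split => //=.
- move=> x ax; apply: phi1 => j h /Ha/(_ x); apply: lt_le_trans.
  by rewrite mulr_gt0.
move=> j g Gg gN.
have [mg g0] := G_good Gg; have [mphi phi0] := gphi j.
have [ma _] := G_good (Ga j).
have Hh : H j (fun x => (1 - c) * g x + c * a j x) by exists g.
have gphi0 x : (0 <= (g x * phi j x)%:E)%E by rewrite lee_fin mulr_ge0.
have : ((1 - c)%:E * \int[mu]_x (g x * phi j x)%:E <= (B + (2 * N)^-1)%:E)%E.
  apply: le_trans (phiH j _ Hh).
  rewrite -ge0_integralZl_EFin ?(ltW c1')//; last by apply/measurable_EFinP/measurable_funM.
  apply: ge0_le_integral => //.
  - by move=> x _; rewrite mule_ge0// lee_fin ltW.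
  - by apply: emeasurable_funM => //; apply/measurable_EFinP/measurable_funM.
  - apply/measurable_EFinP/measurable_funM => //.
    by apply: measurable_funD; exact: measurable_funM.
  move=> x _; rewrite -EFinM lee_fin mulrA ler_wpM2r// lerDl.
  by rewrite mulr_ge0// ltW.
case: (\int[mu]_x _)%E => [I| |]; last 2 first.
- by rewrite gt0_muley ?lte_fin.
- by rewrite leNye.
rewrite -EFinM !lee_fin -/N => I_le; rewrite -(ler_pM2l c1') (le_trans I_le)//.
have e1 : N^-1 <= 1 by rewrite invf_le1.
have e2 : c * (B + 1) = (2 * N)^-1 by rewrite /c invfM mulfVK// gt_eqF.
have e3 : c * (B + N^-1) <= (2 * N)^-1 by rewrite -e2 ler_pM2l// lerD2l.
have e4 : N^-1 = (2 * N)^-1 + (2 * N)^-1 by field; rewrite gt_eqF.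
rewrite mulrBl mul1r lerBrDr; apply: (@le_trans _ _ (B + (2 * N)^-1 + (2 * N)^-1)).
  by rewrite lerD2l.
by rewrite -addrA -e4.
Qed.

Let Phi_directed i k : exists l, Phi l `<=` Phi i /\ Phi l `<=` Phi k.
Proof.
case: i k => [[a Ga] n] [[b Gb] m].
have Gc j : G j (fun x => (1 - 2^-1) * a j x + 2^-1 * b j x).
  by apply: G_convex => //; rewrite invr_ge0 ler0n invf_le1// ler1n.
have a0 j x : 0 <= a j x by have [_] := G_good (Ga j).
have b0 j x : 0 <= b j x by have [_] := G_good (Gb j).
pose c j x := (1 - 2^-1) * a j x + 2^-1 * b j x.
have cE j x : c j x = (a j x + b j x) / 2 by rewrite /c; lra.
pose N := (2 * (maxn n m).+1).-1.
have NE : N.+1%:R = 2 * (maxn n m).+1%:R :> R by rewrite /N prednK// natrM.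
exists (exist _ c Gc, N); split => phi [gphi phi1 phiG]; split => //=.
- move=> x ax; apply: phi1 => j /=; rewrite cE divr_gt0// ltr_pwDl// ax.
- move=> j g Gg gn; apply: (le_trans (phiG j g Gg _)) => /=.
    move=> x; apply: (le_trans (gn x)); rewrite /= NE cE.
    have -> : 2 * (maxn n m).+1%:R * ((a j x + b j x) / 2) =
      (maxn n m).+1%:R * (a j x + b j x) by field.
    by apply: ler_pM => //; rewrite ?ler_nat ?ltnS ?leq_maxl// lerDl.
  rewrite lee_fin lerD2l lef_pV2 ?posrE// NE (@le_trans _ _ (maxn n m).+1%:R)//.
    by rewrite ler_nat ltnS leq_maxl.
  by rewrite ler_peMl// ler1n.
- move=> x bx; apply: phi1 => j /=; rewrite cE divr_gt0// ltr_wpDl// bx.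
- move=> j g Gg gn; apply: (le_trans (phiG j g Gg _)) => /=.
    move=> x; apply: (le_trans (gn x)); rewrite /= NE cE.
    have -> : 2 * (maxn n m).+1%:R * ((a j x + b j x) / 2) =
      (maxn n m).+1%:R * (a j x + b j x) by field.
    by apply: ler_pM => //; rewrite ?ler_nat ?ltnS ?leq_maxr// lerDr.
  rewrite lee_fin lerD2l lef_pV2 ?posrE// NE (@le_trans _ _ (maxn n m).+1%:R)//.
    by rewrite ler_nat ltnS leq_maxr.
  by rewrite ler_peMl// ler1n.
Qed.

(** The constraint on the product is stable under midpoints because the arithmetic
    mean dominates the geometric one, factor by factor. *)
Let Phi_mid i phi psi : Phi i phi -> Phi i psi ->
  Phi i (fun j x => (phi j x + psi j x) / 2).
Proof.
move=> [gphi phi1 phiG] [gpsi psi1 psiG]; split.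
- move=> j; have [m1 p1] := gphi j; have [m2 p2] := gpsi j; split.
    by apply: measurable_funM => //; exact: measurable_funD.
  by move=> x; rewrite divr_ge0// addr_ge0.
- move=> x ax; have h1 := phi1 x ax; have h2 := psi1 x ax.
  rewrite -(@expr_ge1 _ 2)// ?ge0_prod_powR//.
  apply: (le_trans (mulr_ege1 h1 h2)); rewrite expr2 -!big_split/=.
  apply: ler_prod => j _; rewrite mulr_ge0 ?powR_ge0//=.
  have [_ p1] := gphi j; have [_ p2] := gpsi j.
  have s0 : 0 <= (phi j x + psi j x) / 2 by rewrite divr_ge0// addr_ge0.
  rewrite -!powRM//; apply: ge0_ler_powR; rewrite ?nnegrE ?(mulr_ge0 s0 s0) ?(mulr_ge0 (p1 x) (p2 x))
    ?(ltW (theta_gt0 j))//.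
  have := sqr_ge0 (phi j x - psi j x); nra.
move=> j g Gg ga; have := phiG j g Gg ga; have := psiG j g Gg ga.
have [mg g0] := G_good Gg; have [m1 p1] := gphi j; have [m2 p2] := gpsi j.
have := @ge0_integral_axpy R disp X mu 1 (fun x => g x * phi j x) (fun x => g x * psi j x).
move=> /(_ _ _ _ _ ler01) e psi_le phi_le.
have {}e : (2%:E * \int[mu]_x (g x * ((phi j x + psi j x) / 2))%:E =
  \int[mu]_x (g x * phi j x)%:E + 1%:E * \int[mu]_x (g x * psi j x)%:E)%E.
  rewrite -e; [|exact: measurable_funM|exact: measurable_funM
    |by move=> x; rewrite mulr_ge0|by move=> x; rewrite mulr_ge0].
  rewrite -ge0_integralZl_EFin//.
  - by apply: eq_integral => x _; rewrite -EFinM; congr (_%:E); field.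
  - by move=> x _; rewrite lee_fin mulr_ge0// divr_ge0// addr_ge0.
  - apply/measurable_EFinP/measurable_funM => //.
    by apply: measurable_funM => //; exact: measurable_funD.
move: (leeD phi_le psi_le); rewrite -[X in (_ + X <= _)%E]mul1e -e.
case: (\int[mu]_x (g x * (_ / 2))%:E)%E => [I| |].
- rewrite -EFinM -EFinD !lee_fin; move: (B + _) => b h.
  lra.
- by rewrite gt0_muley ?lte_fin.
- by move=> _; rewrite leNye.
Qed.

Lemma saturate_jointly E : measurable E -> (0 < mu E)%E ->
  exists E' a, [/\ measurable E', E' `<=` E, (0 < mu E')%E, forall j, G j (a j) &
    {ae mu, forall x, E' x -> forall j, 0 < a j x}].
Proof.
move=> mE E0; have [g0 Gg0] := choice G_neq0.
suff [E' [a [? ? ? ? h]]] : exists E' a, [/\ measurable E', E' `<=` E, (0 < mu E')%E,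
    forall j, G j (a j) &
    {ae mu, forall x, E' x -> forall j, j \in enum 'I_d -> 0 < a j x}].
  exists E', a; split => //; apply: filterS h => x h E'x j.
  by apply: h; rewrite ?mem_enum.
elim: (enum 'I_d) => [|j s [E1 [a [mE1 E1E E1pos Ga h]]]].
  by exists E, g0; split => //; apply: aeW.
have [E2 [g [mE2 E2E1 E2pos Gg gpos]]] := G_saturates j mE1 E1pos.
exists E2, (fun i => if i == j then g else a i); split => //.
- exact: subset_trans E1E.
- by move=> i; case: eqP => [->|].
apply: filterS2 h gpos => x ha hg E2x i; rewrite inE => /orP[/eqP ->|si].
  by rewrite eqxx; exact: hg.
by case: eqP => _; [exact: hg|exact: ha (E2E1 _ E2x) _ si].
Qed.

(** The weights are the limit of near-solutions. By Fatou, the integral bound passes to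
    the limit for every member of [G j]; together with saturation it shows that the limit weights are
    finite, and saturation for all [j] at once gives the lower bound on the product. *)
Theorem disentangling_weights : exists phi : 'I_d -> X -> R,
  [/\ forall j, measurable_fun setT (phi j) /\ forall x, 0 <= phi j x,
      {ae mu, forall x, 1 <= \prod_(j < d) phi j x `^ theta j} &
      forall j g, G j g -> (\int[mu]_x (g x * phi j x)%:E <= B%:E)%E].
Proof.
have [nu [nu_fin nu_mu]] := finite_measure_of_sigma_finite mu.
have [g0 Gg0] := choice G_neq0.
have [u [mu_u u01 u_lim]] := directed_midpoint_convex_limit nu_fin
  (exist _ g0 Gg0 : sel, 0%N) Phi_directed Phi_neq0
  (fun i phi (h : Phi i phi) => let: And3 h1 _ _ := h in h1) Phi_mid.
have u0 j x : 0 <= u j x by have /andP[] := u01 j x.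
have {}u_lim i : exists phi : nat -> 'I_d -> X -> R, (forall n, Phi i (phi n)) /\
    {ae mu, forall x, forall j, expR (- (phi n j x / 2)) @[n --> \oo] --> u j x}.
  have [phi [Pphi [N [mN N0 hN]]]] := u_lim i.
  by exists phi; split => //; exists N; split => //; exact: nu_mu.
have undamp_ge0 j x : (0 <= undamp (u j x))%E.
  rewrite /undamp; case: eqP => // _; rewrite lee_fin mulNr oppr_ge0.
  by rewrite pmulr_rle0// ln_le0//; have /andP[] := u01 j x.
have m_undamp j : measurable_fun setT (fun x => undamp (u j x)).
  apply: measurable_fun_ifT => //.
    exact: measurable_fun_eqr.
  apply/measurable_EFinP/measurable_funM => //.
  exact: measurableT_comp.
have bound j g : G j g -> (\int[mu]_x ((g x)%:E * undamp (u j x)) <= B%:E)%E.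
  move=> Gg; have [mg gge0] := G_good Gg.
  pose a i := if i == j then g else g0 i.
  have Ga i : G i (a i) by rewrite /a; case: eqP => [->|].
  apply/lee_addgt0Pr => e e0.
  pose n := Num.truncn e^-1.
  have ne : n.+1%:R^-1 <= e.
    by rewrite invf_ple ?posrE// ltW// truncnS_gt.
  have [phi [Pphi phi_u]] := u_lim (exist _ a Ga : sel, n).
  apply: (@le_trans _ _ (B + n.+1%:R^-1)%:E); last by rewrite lee_fin lerD2l.
  apply: (@ae_fatou_le _ _ _ _ (fun k x => g x * phi k j x)).
  - by move=> k; have [gphi _ _] := Pphi k; apply: measurable_funM => //; have [] := gphi j.
  - move=> k x; have [gphi _ _] := Pphi k; rewrite mulr_ge0//.
    by have [_] := gphi j.
  - by apply: emeasurable_funM => //; exact/measurable_EFinP.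
  - by move=> x; rewrite mule_ge0// lee_fin.
  - by apply: filterS phi_u => x h; apply: cvg_undamp.
  - move=> k; have [_ _] := Pphi k; apply => // x.
    by rewrite /= /a eqxx ler_peMl// ler1n.
have u_gt0 j : {ae mu, forall x, 0 < u j x}.
  pose E := [set x | u j x = 0].
  have mE : measurable E.
    rewrite (_ : E = u j @^-1` [set 0]); last by apply/seteqP; split.
    by rewrite -[_ @^-1` _]setTI; apply: mu_u.
  have [E0|Epos] := eqVneq (mu E) 0%E.
    exists E; split => // x /= h; apply/eqP; rewrite eq_le u0 andbT leNgt.
    exact/negP.
  have {}Epos : (0 < mu E)%E by rewrite lt_neqAle eq_sym Epos measure_ge0.
  have [E' [g [mE' E'E E'pos Gg gpos]]] := G_saturates j mE Epos.
  have [mg gge0] := G_good Gg.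
  have ig : mu.-integrable setT (fun x => (g x)%:E * undamp (u j x))%E.
    apply/integrableP; split.
      by apply: emeasurable_funM => //; exact/measurable_EFinP.
    under eq_integral do rewrite gee0_abs ?mule_ge0 ?lee_fin//.
    exact: le_lt_trans (bound _ _ Gg) (ltry _).
  suff : mu E' = 0%E by move=> e; rewrite e ltxx in E'pos.
  apply: measure0_of_ae_not => //.
  apply: filterS2 gpos (integrable_ae measurableT ig) => x hg fin E'x.
  have := fin Logic.I; rewrite /undamp (E'E _ E'x) eqxx gt0_muley//.
  by rewrite lte_fin; exact: hg.
have {}u_gt0 : {ae mu, forall x, forall j, 0 < u j x}.
  have : {ae mu, forall x, forall j, j \in enum 'I_d -> 0 < u j x}.
    elim: (enum 'I_d) => [|j s IH]; first exact: aeW.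
    apply: filterS2 (u_gt0 j) IH => x h1 h2 i; rewrite inE => /orP[/eqP ->//|].
    exact: h2.
  by apply: filterS => x h j; apply: h; rewrite mem_enum.
pose phi j x := - 2 * ln (u j x).
have phi_ge0 j x : 0 <= phi j x.
  by rewrite /phi mulNr oppr_ge0 pmulr_rle0// ln_le0//; have /andP[] := u01 j x.
have mphi j : measurable_fun setT (phi j).
  by apply: measurable_funM => //; exact: measurableT_comp.
exists phi; split => //.
- pose N := [set x | \prod_(j < d) phi j x `^ theta j < 1].
  have mN : measurable N.
    have mp := measurable_prod_powR theta mphi.
    rewrite (_ : N = (fun x => \prod_(j < d) phi j x `^ theta j) @^-1` `]-oo, 1[).
      by rewrite -[_ @^-1` _]setTI; apply: mp.
    by apply/seteqP; split => x; rewrite /= in_itv.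
  have [N0|Npos] := eqVneq (mu N) 0%E.
    by exists N; split => // x /= /negP; rewrite -ltNge.
  have {}Npos : (0 < mu N)%E by rewrite lt_neqAle eq_sym Npos measure_ge0.
  have [E' [a [mE' E'N E'pos Ga apos]]] := saturate_jointly mN Npos.
  suff : mu E' = 0%E by move=> e; rewrite e ltxx in E'pos.
  apply: measure0_of_ae_not => //.
  have [f [Pf f_u]] := u_lim (exist _ a Ga : sel, 0%N).
  apply: filterS3 apos f_u u_gt0 => x ax fx ux E'x.
  have : \prod_(j < d) phi j x `^ theta j < 1 := E'N _ E'x; rewrite ltNge => /negP; apply.
  have f_phi j : (fun n => f n j x) @ \oo --> phi j x.
    have fE : (fun n => f n j x) = (fun n => - 2 * ln (expR (- (f n j x / 2)))).
      by apply/funext => n; rewrite expRK mulrNN mulrC divfK.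
    rewrite fE; apply: cvgMr.
    exact: (cvg_comp _ _ (fx j) (continuous_ln (ux j))).
  have lim_prod : (fun n => \prod_(j < d) f n j x `^ theta j) @ \oo -->
      \prod_(j < d) phi j x `^ theta j.
    apply: cvg_prod_real => j; apply: cvg_powR_ge0 => // n.
    by have [gf _ _] := Pf n; have [_] := gf j.
  rewrite -(cvg_lim (@Rhausdorff R) lim_prod); apply: limr_ge.
    by apply/cvg_ex; exists (\prod_(j < d) phi j x `^ theta j).
  apply: nearW => n; have [_ h _] := Pf n; apply: h => j /=.
  exact: ax.
move=> j g Gg; apply: le_trans (bound j g Gg); have [mg gge0] := G_good Gg.
apply: ge0_le_integral => //.
- by move=> x _; rewrite lee_fin mulr_ge0.
- by apply/measurable_EFinP/measurable_funM.
- by apply: emeasurable_funM => //; exact/measurable_EFinP.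
move=> x _; rewrite EFinM lee_wpmul2l ?lee_fin// /undamp.
by case: eqP => // _; rewrite leey.
Qed.

End weights.

(** * Normed lattices, the lattice calculus and positive operators *)

Section normed_lattice.
Context (R : realType) (Y : normedLatticeType R).
Implicit Types x y z : Y.

Lemma nlat_lerD2 x y z : x <= y -> x + z <= y + z.
Proof. exact: nlat_leD. Qed.

Lemma nlat_lerZ (a : R) x y : 0 <= a -> x <= y -> a *: x <= a *: y.
Proof. exact: nlat_leZ. Qed.

Lemma nlat_subr_ge0 x y : (0 <= y - x) = (x <= y).
Proof.
apply/idP/idP => [h|h]; first by have := nlat_lerD2 x h; rewrite add0r subrK.
by have := nlat_lerD2 (- x) h; rewrite subrr.
Qed.

Lemma nlat_addr_ge0 x y : 0 <= x -> 0 <= y -> 0 <= x + y.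
Proof. by move=> x0 y0; have := nlat_lerD2 y x0; rewrite add0r; apply: le_trans. Qed.

Definition modulus x : Y := Order.join x (- x).

Lemma le_modulus x : x <= modulus x. Proof. exact: leUl. Qed.

Lemma leN_modulus x : - x <= modulus x. Proof. exact: leUr. Qed.

(** Both [modulus x - x] and [modulus x + x] are nonnegative; halve their sum. *)
Lemma modulus_ge0 x : 0 <= modulus x.
Proof.
have h : 0 <= modulus x + modulus x.
  have h1 : 0 <= modulus x - x by rewrite nlat_subr_ge0 le_modulus.
  have h2 : 0 <= modulus x + x by rewrite -[X in _ + X]opprK nlat_subr_ge0 leN_modulus.
  by have := nlat_addr_ge0 h1 h2; rewrite addrACA addNr addr0.
have e : modulus x + modulus x = 2 *: modulus x by rewrite scaler_nat mulr2n.
have := @nlat_lerZ 2^-1 _ _ _ h; rewrite scaler0 e scalerA.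
by rewrite mulVf ?pnatr_eq0// scale1r; apply; rewrite invr_ge0.
Qed.

Lemma modulus_id x : 0 <= x -> modulus x = x.
Proof.
move=> x0; apply: join_l; rewrite -nlat_subr_ge0 opprK.
exact: nlat_addr_ge0.
Qed.

Lemma norm_le_of_modulus_le x y : modulus x <= modulus y -> `|x| <= `|y|.
Proof. exact: nlat_le_norm. Qed.

Lemma norm_modulus x : `|modulus x| = `|x|.
Proof.
by apply/le_anti; rewrite !norm_le_of_modulus_le// (modulus_id (modulus_ge0 x)).
Qed.

Lemma nlat_norm_le x y : 0 <= x -> x <= y -> `|x| <= `|y|.
Proof.
move=> x0 xy; apply: norm_le_of_modulus_le.
by rewrite !modulus_id// (le_trans x0).
Qed.

End normed_lattice.

Section calculus.
Context (R : realType) (Y : normedLatticeType R) (n : nat).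
Variables (f : 'I_n -> Y) (L : set ('rV[R]_n -> R)) (Phi : ('rV[R]_n -> R) -> Y).
Hypothesis LPhi : lattice_calculus f L Phi.

Lemma calculus_mono u v : L u -> L v -> (forall t, u t <= v t) -> Phi u <= Phi v.
Proof.
move=> Lu Lv uv; rewrite -[X in _ <= X](_ : Order.join (Phi u) (Phi v) = _) ?leUl//.
rewrite -(lcalc_morph_max LPhi Lu Lv); congr Phi; apply/funext => t.
exact: max_r.
Qed.

Lemma calculus_zero h : L h -> L (fun=> 0) /\ Phi (fun=> 0) = 0.
Proof.
move=> Lh; have -> : (fun=> 0) = (fun t => -1 * h t + h t).
  by apply/funext => t; rewrite mulN1r addNr.
by rewrite (lcalc_morph_lin LPhi) ?scaleN1r ?addNr//; split => //; exact: (lcalc_lin LPhi).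
Qed.

Lemma calculus_linear_form h (a : 'I_n -> R) : L h ->
  L (fun t => \sum_(k < n) a k * t ord0 k) /\
  Phi (fun t => \sum_(k < n) a k * t ord0 k) = \sum_(k < n) a k *: f k.
Proof.
move=> /calculus_zero[L0 Phi0]; elim: (index_enum _) => [|k s [IHL IHPhi]].
  by rewrite big_nil -Phi0; split; [move: L0|]; congr (_ _); apply/funext => t; rewrite big_nil.
have -> : (fun t : 'rV[R]_n => \sum_(i <- k :: s) a i * t ord0 i) =
    (fun t => a k * t ord0 k + \sum_(i <- s) a i * t ord0 i).
  by apply/funext => t; rewrite big_cons.
have Lk := lcalc_coord LPhi k.
rewrite big_cons (lcalc_morph_lin LPhi)// (lcalc_morph_coord LPhi) IHPhi; split => //.
exact: (lcalc_lin LPhi).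
Qed.

End calculus.

Lemma lp_value_ge0 (R : realType) (Y : normedLatticeType R) (p : R) (n : nat)
    (f : 'I_n -> Y) (g : Y) : lattice_value f (@lp_norm R p n) g -> 0 <= g.
Proof.
move=> [L [Phi [LPhi Lh <-]]]; have [L0 <-] := calculus_zero LPhi Lh.
by apply: (calculus_mono LPhi) => // t; exact: powR_ge0.
Qed.

Lemma lp_value_ge_tangent (R : realType) (Y : normedLatticeType R) (p : R) (n : nat)
    (f : 'I_n -> Y) (g : Y) (b : 'I_n -> R) :
  lattice_value f (@lp_norm R p n) g -> 1 <= p -> (forall k, 0 <= b k) ->
  0 < \sum_(k < n) b k `^ p ->
  \sum_(k < n) (b k `^ (p - 1)) *: f k <= ((\sum_(k < n) b k `^ p) `^ (1 - p^-1)) *: g.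
Proof.
move=> [L [Phi [LPhi Lh <-]]] p1 b0 bpos.
have [L0 Phi0] := calculus_zero LPhi Lh.
have [Lb <-] := calculus_linear_form LPhi (fun k => b k `^ (p - 1)) Lh.
set c := _ `^ (1 - _); rewrite -[X in _ <= X]addr0 -Phi0 -(lcalc_morph_lin LPhi)//.
apply: (calculus_mono LPhi) => //; first exact: (lcalc_lin LPhi).
by move=> t; rewrite addr0; exact: holder_lp_norm.
Qed.

Section operators.
Context (R : realType) (Y : normedLatticeType R) (disp : measure_display).
Context (X : measurableType disp) (mu : {measure set X -> \bar R}).
Variable T : Y -> {mfun X >-> R}.
Hypothesis T_linear : ae_linear mu T.

Lemma ae_linear0 : {ae mu, forall x, T 0 x = 0}.
Proof.
have := T_linear 1 0 0; rewrite scaler0 addr0; apply: filterS => x.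
by rewrite mul1r => /eqP; rewrite -subr_eq0 opprD addNKr oppr_eq0 => /eqP.
Qed.

Lemma ae_linearZ a f : {ae mu, forall x, T (a *: f) x = a * T f x}.
Proof.
by have := T_linear a f 0; rewrite addr0; apply: filterS2 ae_linear0 => x -> ->; rewrite addr0.
Qed.

Lemma ae_linear_sum (n : nat) (a : 'I_n -> R) (f : 'I_n -> Y) :
  {ae mu, forall x, T (\sum_(k < n) a k *: f k) x = \sum_(k < n) a k * T (f k) x}.
Proof.
elim: (index_enum _) => [|k s IH].
  by rewrite big_nil; apply: filterS ae_linear0 => x ->; rewrite big_nil.
rewrite big_cons.
apply: filterS2 IH (T_linear (a k) (f k) (\sum_(i <- s) a i *: f i)) => x IHx ->.
by rewrite IHx big_cons.
Qed.

Hypothesis T_positive : positive_op mu T.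

Lemma ae_positive_mono f g : f <= g -> {ae mu, forall x, T f x <= T g x}.
Proof.
rewrite -nlat_subr_ge0 => /T_positive; apply: filterS2 (T_linear 1 (g - f) f) => x.
by rewrite scale1r subrK mul1r => -> h; rewrite lerDr.
Qed.

Lemma ae_positive_modulus f : {ae mu, forall x, `|T f x| <= T (modulus f) x}.
Proof.
have h1 := ae_positive_mono (le_modulus f); have h2 := ae_positive_mono (leN_modulus f).
have := ae_linearZ (-1) f; rewrite scaleN1r; apply: filterS3 h1 h2 => x h1 h2 e.
by rewrite ler_norml lerNl h1 andbT -mulN1r -e.
Qed.

End operators.

Lemma ae_forall_countable (R : realType) (disp : measure_display)
    (X : measurableType disp) (mu : {measure set X -> \bar R}) (I : countType)
    (P : I -> X -> Prop) :
  (forall i, {ae mu, forall x, P i x}) -> {ae mu, forall x, forall i, P i x}.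
Proof.
move=> aeP; have : {ae mu, forall x, forall n : nat,
    if unpickle n is Some i then P i x else True}.
  by apply: ae_foralln => n; case: unpickle => [i|]; [exact: aeP|exact: aeW].
by apply: filterS => x h i; have := h (pickle i); rewrite pickleK.
Qed.

(** A positive operator respects each of the countably many tangent inequalities
    of the l^p norm at rational points, and these determine the norm. *)
Lemma ae_positive_lp_value (R : realType) (Y : normedLatticeType R)
    (disp : measure_display) (X : measurableType disp)
    (mu : {measure set X -> \bar R}) (T : Y -> {mfun X >-> R}) (p : R) (n : nat)
    (f : 'I_n -> Y) (g : Y) :
  ae_linear mu T -> positive_op mu T -> 1 <= p -> (forall k, 0 <= f k) ->
  lattice_value f (@lp_norm R p n) g ->
  {ae mu, forall x, \sum_(k < n) T (f k) x `^ p <= T g x `^ p}.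
Proof.
move=> Tl Tp p1 f0 fg.
have n0 : (0 < n)%N \/ n = 0%N by case: (n) => [|m]; [right|left].
case: n0 => [n0|n0]; last first.
  by subst n; apply: aeW => x; rewrite big_ord0 powR_ge0.
pose b (i : nat * {ffun 'I_n -> nat}) (k : 'I_n) : R := (i.2 k).+1%:R / i.1.+1%:R.
have b0 i k : 0 < b i k by rewrite divr_gt0.
have tangent : {ae mu, forall x, forall i, \sum_(k < n) b i k `^ (p - 1) * T (f k) x <=
    (\sum_(k < n) b i k `^ p) `^ (1 - p^-1) * T g x}.
  apply: ae_forall_countable => i.
  have S0 : 0 < \sum_(k < n) b i k `^ p.
    rewrite (bigD1 (Ordinal n0))//= ltr_pwDl ?powR_gt0//.
    by apply: sumr_ge0 => k _; exact: powR_ge0.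
  have := ae_positive_mono Tl Tp (lp_value_ge_tangent fg p1 (fun k => ltW (b0 i k)) S0).
  set c := _ `^ (1 - _).
  apply: filterS3 (ae_linear_sum Tl (fun k => b i k `^ (p - 1)) f) (ae_linearZ Tl c g).
  by move=> x -> ->.
have Tf0 : {ae mu, forall x, forall k, 0 <= T (f k) x}.
  by apply: ae_forall_countable => k; exact: Tp.
apply: filterS3 tangent Tf0 (Tp _ (lp_value_ge0 fg)) => x tx fx gx.
apply: powR_sum_le_of_tangents => // _ [N [m ->]].
have := tx (N, [ffun k => m k]); rewrite /b/=.
by under eq_bigr do rewrite ffunE; under [X in X `^ _]eq_bigr do rewrite ffunE.
Qed.

(** * The convex sets attached to the operators *)

(** The normalisation is the one for which [p]-convexity with constant [C] yields
    an [F] in the unit ball with [(T F) ^ p] dominating the sum. Scalar weights, rather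
    than weights absorbed in the vectors, make the set convex everywhere and not only
    almost everywhere. *)
Definition power_sums (R : realType) (Y : normedLatticeType R)
    (disp : measure_display) (X : measurableType disp) (T : Y -> {mfun X >-> R})
    (p C : R) : set (X -> R) :=
  [set g | exists s : seq (R * Y), [/\ all (fun q => 0 <= q.1) s,
    \sum_(q <- s) q.1 * (C * `|q.2|) `^ p <= 1 &
    g = fun x => \sum_(q <- s) q.1 * `|T q.2 x| `^ p]].

Section power_sums.
Context (R : realType) (Y : normedLatticeType R) (disp : measure_display).
Context (X : measurableType disp) (mu : {measure set X -> \bar R}).
Variables (T : Y -> {mfun X >-> R}) (p C : R).

Lemma measurable_norm_powR (f : Y) : measurable_fun setT (fun x => `|T f x| `^ p).
Proof.
apply: (measurableT_comp (measurable_powR _)).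
exact: measurableT_comp.
Qed.

Lemma power_sums_neq0 : power_sums T p C !=set0.
Proof.
exists (fun x => \sum_(q <- [::] : seq (R * Y)) q.1 * `|T q.2 x| `^ p).
by exists [::]; split => //; rewrite big_nil.
Qed.

Lemma power_sums_good g : power_sums T p C g ->
  measurable_fun setT g /\ forall x, 0 <= g x.
Proof.
move=> [s [/allP s0 _ ->]]; split.
  apply: measurable_sum => q; apply: measurable_funM => //.
  exact: measurable_norm_powR.
by move=> x; rewrite big_seq; apply: sumr_ge0 => q /s0 q0; rewrite mulr_ge0// powR_ge0.
Qed.

Lemma power_sums_convex g h (t : R) : power_sums T p C g -> power_sums T p C h ->
  0 <= t <= 1 -> power_sums T p C (fun x => (1 - t) * g x + t * h x).
Proof.
move=> [s [s0 s1 ->]] [r [r0 r1 ->]] /andP[t0 t1].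
have t1' : 0 <= 1 - t by rewrite subr_ge0.
exists ([seq ((1 - t) * q.1, q.2) | q <- s] ++ [seq (t * q.1, q.2) | q <- r]); split.
- rewrite all_cat !all_map; apply/andP; split.
    by apply: sub_all s0 => q /= q0; rewrite mulr_ge0.
  by apply: sub_all r0 => q /= q0; rewrite mulr_ge0.
- rewrite big_cat !big_map/=; under eq_bigr do rewrite -mulrA.
  under [X in _ + X]eq_bigr do rewrite -mulrA.
  rewrite -!mulr_sumr; apply: (@le_trans _ _ ((1 - t) * 1 + t * 1)).
    by apply: lerD; apply: ler_wpM2l.
  by rewrite !mulr1 subrK.
apply/funext => x; rewrite big_cat !big_map/= !mulr_sumr.
by congr (_ + _); apply: eq_bigr => q _; rewrite mulrA.
Qed.

Lemma single_power_sum f (c : R) : 0 <= c -> c * (C * `|f|) `^ p <= 1 ->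
  power_sums T p C (fun x => c * `|T f x| `^ p).
Proof.
move=> c0 c1; exists [:: (c, f)]; split; rewrite /= ?c0 ?big_seq1//.
by apply/funext => x; rewrite big_seq1.
Qed.

Lemma power_sums_saturates : saturates mu T ->
  forall E, measurable E -> (0 < mu E)%E ->
  exists E' g, [/\ measurable E', E' `<=` E, (0 < mu E')%E, power_sums T p C g &
    {ae mu, forall x, E' x -> 0 < g x}].
Proof.
move=> sat E mE E0; have [E' [mE' E'E E'0 [h hpos]]] := sat E mE E0.
pose w := 1 + (C * `|h|) `^ p.
have w0 : 0 < w by rewrite ltr_pwDl// powR_ge0.
exists E', (fun x => w^-1 * `|T h x| `^ p); split => //.
  apply: single_power_sum; first by rewrite invr_ge0 ltW.
  by rewrite mulrC ler_pdivrMr// mul1r lerDr.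
apply: filterS hpos => x hx E'x; rewrite mulr_gt0 ?invr_gt0// powR_gt0//.
exact: hx.
Qed.

Hypothesis p_ge1 : 1 <= p.
Hypothesis T_linear : ae_linear mu T.
Hypothesis T_positive : positive_op mu T.
Hypothesis C_gt0 : 0 < C.

(** This is where [p]-convexity enters: the [l^p] combination of the moduli of the
    rescaled [f] has controlled norm, and its image dominates. *)
Lemma power_sums_dominated g C' : 0 <= C' -> p_convex_with p Y C' ->
  power_sums T p C g -> exists F : Y, [/\ 0 <= F, `|F| <= C' / C &
    {ae mu, forall x, g x <= T F x `^ p}].
Proof.
move=> C'0 convex [s [/allP s0 s1 ->]].
have p0 : 0 < p by exact: lt_le_trans p_ge1.
have pn0 : p != 0 by rewrite gt_eqF.
have pV0 : 0 <= p^-1 by rewrite invr_ge0 ltW.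
pose q (k : 'I_(size s)) := tnth (in_tuple s) k.
have q0 k : 0 <= (q k).1 by apply: s0; exact: mem_tnth.
pose f k := (q k).1 `^ p^-1 *: modulus (q k).2.
have f0 k : 0 <= f k.
  by rewrite -(scaler0 _ ((q k).1 `^ p^-1)); apply: nlat_lerZ; rewrite ?powR_ge0 ?modulus_ge0.
have [F Fval Fnorm] := convex _ f.
exists F; split; first exact: lp_value_ge0 Fval.
  apply: (le_trans Fnorm); rewrite ler_wpM2l//.
  have fk k : `|f k| `^ p = (q k).1 * `|(q k).2| `^ p.
    rewrite /f normrZ norm_modulus ger0_norm ?powR_ge0// powRM ?powR_ge0//.
    by rewrite -powRrM mulVf// powRr1.
  under eq_bigr do rewrite fk.
  have Cp0 : 0 < C `^ p by exact: powR_gt0.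
  have sum_le : \sum_(k < size s) (q k).1 * `|(q k).2| `^ p <= (C `^ p)^-1.
    rewrite -[leRHS]mul1r ler_pdivlMr// mulr_suml; apply: le_trans s1.
    rewrite (big_tnth _ _ s) le_eqVlt; apply/orP; left; apply/eqP.
    by apply: eq_bigr => k _; rewrite powRM ?(ltW C_gt0)// -mulrA [C `^ p * _]mulrC.
  have -> : C^-1 = ((C `^ p)^-1) `^ p^-1.
    by rewrite -powRN -powRrM mulNr mulfV// powR_inv1// ltW.
  apply: ge0_ler_powR; rewrite ?nnegrE ?invr_ge0 ?(ltW Cp0) ?(ltW p0)//.
  by apply: sumr_ge0 => k _; rewrite mulr_ge0// powR_ge0.
have Tmod : {ae mu, forall x, forall k, `|T (q k).2 x| <= T (modulus (q k).2) x}.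
  by apply: ae_forall_countable => k; exact: ae_positive_modulus.
have Tf : {ae mu, forall x, forall k, T (f k) x = (q k).1 `^ p^-1 * T (modulus (q k).2) x}.
  by apply: ae_forall_countable => k; exact: ae_linearZ.
apply: filterS3 Tmod Tf (ae_positive_lp_value T_linear T_positive p_ge1 f0 Fval).
move=> x hmod hf; apply: le_trans; rewrite (big_tnth _ _ s).
apply: ler_sum => k _; rewrite hf powRM ?powR_ge0//; last first.
  exact: le_trans (normr_ge0 _) (hmod k).
rewrite -powRrM mulVf// powRr1// ler_wpM2l//.
by apply: ge0_ler_powR; rewrite ?nnegrE ?(ltW p0)// (le_trans _ (hmod k)).
Qed.

End power_sums.

(** In particular the best constant is positive, so one can divide by it. *)
Lemma p_convex_with_ge1 (R : realType) (Y : normedLatticeType R) (p C : R) (y : Y) :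
  1 <= p -> y != 0 -> p_convex_with p Y C -> 1 <= C.
Proof.
move=> p1 y0 convex.
have pn0 : p != 0 by rewrite gt_eqF// (lt_le_trans _ p1).
have a0 := modulus_ge0 y.
have [F Fval] := convex 1%N (fun=> modulus y).
rewrite big_ord1 -powRrM mulfV// powRr1// norm_modulus => Fnorm.
have := lp_value_ge_tangent (b := fun=> 1) Fval p1 (fun=> ler01).
rewrite !big_ord1 !powR1 !scale1r => /(_ ltr01) /(nlat_norm_le a0).
rewrite norm_modulus => /le_trans/(_ Fnorm).
by rewrite ler_pMl// normr_gt0.
Qed.

Lemma p_convexity_const_ge0 (R : realType) (Y : normedLatticeType R) (p : R) :
  0 <= p_convexity_const p Y.
Proof.
rewrite /p_convexity_const; set S := [set C | _].
have [->|/set0P S0] := eqVneq S set0; first by rewrite inf0.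
by apply: lb_le_inf => // C [].
Qed.

Lemma p_convexity_const_ge1 (R : realType) (Y : normedLatticeType R) (p : R) (y : Y) :
  1 <= p -> y != 0 -> p_convex p Y -> 1 <= p_convexity_const p Y.
Proof.
move=> p1 y0 [C [C0 convex]]; apply: lb_le_inf; first by exists C.
by move=> D [_ h]; exact: p_convex_with_ge1 p1 y0 h.
Qed.

Lemma trivial_of_saturates (R : realType) (Y : normedLatticeType R)
    (disp : measure_display) (X : measurableType disp)
    (mu : {measure set X -> \bar R}) (T : Y -> {mfun X >-> R}) :
  ae_linear mu T -> saturates mu T -> (forall y : Y, y = 0) -> mu setT = 0%E.
Proof.
move=> Tl sat Y0; apply/eqP; apply/negPn/negP => mu0.
have mupos : (0 < mu setT)%E by rewrite lt_neqAle eq_sym mu0 measure_ge0.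
have [E [mE _ Epos [h hpos]]] := sat setT measurableT mupos.
suff e : mu E = 0%E by rewrite e ltxx in Epos.
apply: measure0_of_ae_not => //; apply: filterS2 hpos (ae_linear0 Tl) => x hx T0 Ex.
by have := hx Ex; rewrite (Y0 h) T0 normr0 ltxx.
Qed.

(** * The factorisation theorem *)

(** Constants slightly above the infimum, at most [r] times it, do satisfy the
    convexity inequality; they give the bound up to a power of [r], and [r] tends
    to [1]. *)
Lemma power_sums_bound (R : realType) (disp : measure_display)
    (X : measurableType disp) (mu : {measure set X -> \bar R})
    (d : nat) (Y : 'I_d -> normedLatticeType R) (p theta : 'I_d -> R)
    (T : forall j, Y j -> {mfun X >-> R}) (B : R) (g : 'I_d -> X -> R) :
  (forall j, 1 <= p j) -> (forall j, p_convex (p j) (Y j)) ->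
  (forall j, ae_linear mu (T j)) -> (forall j, positive_op mu (T j)) ->
  (forall j, 0 < theta j) -> 0 <= B ->
  (forall j, 0 < p_convexity_const (p j) (Y j)) ->
  (forall f : (forall j, Y j), (forall j, 0 <= f j) ->
    (\int[mu]_x (\prod_(j < d) (T j (f j) x) `^ (p j * theta j))%:E <=
     (B * \prod_(j < d) `|f j| `^ (p j * theta j))%:E)%E) ->
  (forall j, power_sums (T j) (p j) (p_convexity_const (p j) (Y j)) (g j)) ->
  (\int[mu]_x (\prod_(j < d) g j x `^ theta j)%:E <= B%:E)%E.
Proof.
move=> p_ge1 Y_convex Tl Tp theta_gt0 B0 C0 T_bound Gg.
set C := fun j => p_convexity_const (p j) (Y j).
pose Q := \sum_(j < d) p j * theta j.
have pth0 j : 0 < p j * theta j by rewrite mulr_gt0// (lt_le_trans _ (p_ge1 j)).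
have Q0 : 0 <= Q by apply: sumr_ge0 => j _; exact: ltW.
have bound r : 1 < r ->
    (\int[mu]_x (\prod_(j < d) g j x `^ theta j)%:E <= (B * r `^ Q)%:E)%E.
  move=> r1; have r0 : 0 < r by exact: lt_trans r1.
  have F_ex j : exists F : Y j, [/\ 0 <= F, `|F| <= r &
      {ae mu, forall x, g j x <= T j F x `^ p j}].
    have e0 : 0 < (r - 1) * C j by rewrite mulr_gt0 ?subr_gt0//; exact: C0.
    have hinf : has_inf [set D : R | 0 <= D /\ p_convex_with (p j) (Y j) D].
      by split; [exact: Y_convex|exists 0 => D []].
    have [D [D0 Dconv] Dlt] := inf_adherent e0 hinf.
    have [F [F0 FD Fg]] := power_sums_dominated (p_ge1 j) (Tl j) (Tp j) (C0 j) D0 Dconv (Gg j).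
    exists F; split => //; apply: (le_trans FD); rewrite ler_pdivrMr//.
    by apply: (le_trans (ltW Dlt)); rewrite mulrBl mul1r addrC subrK.
  have [F FP] : exists F : (forall j, Y j), forall j, [/\ 0 <= F j, `|F j| <= r &
      {ae mu, forall x, g j x <= T j (F j) x `^ p j}].
    by exists (fun j => sval (cid (F_ex j))) => j; case: (cid (F_ex j)).
  have g_good j := power_sums_good (Gg j).
  apply: (@le_trans _ _ (\int[mu]_x (\prod_(j < d) (T j (F j) x) `^ (p j * theta j))%:E)%E).
    apply: ae_ge0_le_integral => //.
    - by move=> x _; rewrite lee_fin ge0_prod_powR.
    - by apply/measurable_EFinP/measurable_prod_powR => j; have [] := g_good j.
    - move=> x _; rewrite lee_fin; exact: (ge0_prod_powR (fun j => T j (F j) x)).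
    - apply/measurable_EFinP.
      exact: (measurable_prod_powR (fun j => p j * theta j) (g := fun j => T j (F j))).
    have ae_g : {ae mu, forall x, forall j, g j x <= T j (F j) x `^ p j}.
      by apply: ae_forall_countable => j; have [] := FP j.
    apply: filterS ae_g => x gx _; rewrite lee_fin; apply: ler_prod => j _.
    rewrite powR_ge0/= powRrM; apply: ge0_ler_powR; rewrite ?nnegrE ?powR_ge0//.
      exact: ltW.
    by have [_] := g_good j.
  apply: (le_trans (T_bound F _)); first by move=> j; have [] := FP j.
  rewrite lee_fin ler_wpM2l// -prod_powR_exponents//; apply: ler_prod => j _.
  rewrite powR_ge0/=; apply: ge0_ler_powR; rewrite ?nnegrE ?(ltW r0)//.
    exact: ltW.
  by have [] := FP j.
move: (Q0); rewrite le_eqVlt => /predU1P[Qz|Qpos].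
  by have := bound 2; rewrite -Qz powRr0 mulr1; apply; rewrite ltr1n.
apply/lee_addgt0Pr => e e0.
have B1 : 0 < B + 1 by rewrite ltr_wpDl.
have u0 : 0 < e / (B + 1) by rewrite divr_gt0.
pose r := (1 + e / (B + 1)) `^ Q^-1.
have rQ : r `^ Q = 1 + e / (B + 1).
  by rewrite /r -powRrM mulVf ?gt_eqF// powRr1// addr_ge0// ltW.
have r1 : 1 < r.
  have -> : 1 = 1 `^ Q^-1 :> R by rewrite powR1.
  by apply: gt0_ltr_powR; rewrite ?nnegrE ?invr_gt0 ?ltrDl// addr_ge0// ltW.
apply: (le_trans (bound r r1)); rewrite -EFinD lee_fin rQ mulrDr mulr1 lerD2l.
by rewrite mulrA ler_pdivrMr// mulrC ler_wpM2l ?(ltW e0)// lerDl.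
Qed.

Theorem theorem3p2 (R : realType) (disp : measure_display)
    (X : measurableType disp) (mu : {sigma_finite_measure set X -> \bar R})
    (d : nat) (Y : 'I_d -> normedLatticeType R) (p theta : 'I_d -> R)
    (p_ge1 : forall j, 1 <= p j)
    (Y_convex : forall j, p_convex (p j) (Y j))
    (T : forall j, Y j -> {mfun X >-> R})
    (T_linear : forall j, ae_linear mu (T j))
    (T_positive : forall j, positive_op mu (T j))
    (T_saturates : forall j, saturates mu (T j))
    (theta_gt0 : forall j, 0 < theta j)
    (theta_sum : \sum_(j < d) theta j = 1)
    (B : R)
    (T_bound : forall f : (forall j, Y j), (forall j, 0 <= f j) ->
      (\int[mu]_x (\prod_(j < d) (T j (f j) x) `^ (p j * theta j))%:E <=
       (B * \prod_(j < d) `|f j| `^ (p j * theta j))%:E)%E) :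
  exists phi : 'I_d -> {mfun X >-> R},
    [/\ forall j x, 0 <= phi j x,
        {ae mu, forall x, 1 <= \prod_(j < d) (phi j x) `^ (theta j)} &
        forall j (f : Y j),
          ((\int[mu]_x (`|T j f x| `^ (p j) * phi j x)%:E) `^ (p j)^-1 <=
           (B `^ (p j)^-1 * p_convexity_const (p j) (Y j) * `|f|)%:E)%E].
Proof.
(* If some [Y j] is trivial then, by saturation, so is [mu]; otherwise the convexity
   constants are at least [1] and [0 <= B]. *)
have [[j0 triv]|nontriv] := pselect (exists j, forall y : Y j, y = 0).
  have mu0 := trivial_of_saturates (T_linear j0) (T_saturates j0) triv.
  have int0 (f : X -> R) : measurable_fun setT f -> (\int[mu]_x (f x)%:E = 0)%E.
    move=> mf; rewrite -(integral0 mu setT); apply: ae_eq_integral => //.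
      exact/measurable_EFinP.
    exact: ae_eq0.
  exists (fun=> cst 1); split => //.
    by apply: aeW => x; rewrite big1// => j _; rewrite powR1.
  move=> j f; rewrite int0.
    rewrite poweR0r ?lee_fin ?mulr_ge0 ?powR_ge0 ?p_convexity_const_ge0//.
    by rewrite invr_eq0 gt_eqF// (lt_le_trans _ (p_ge1 j)).
  by apply: measurable_funM => //; exact: measurable_norm_powR.
have {nontriv}[y y0] : exists y : (forall j, Y j), forall j, y j != 0.
  have ex j : exists y : Y j, y != 0.
    apply: contrapT => h; apply: nontriv; exists j => y.
    by apply/eqP/negPn/negP => y0; apply: h; exists y.
  by exists (fun j => sval (cid (ex j))) => j; case: (cid (ex j)).
have C1 j : 1 <= p_convexity_const (p j) (Y j) by exact: p_convexity_const_ge1 (p_ge1 j) (y0 j) _.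
have C0 j : 0 < p_convexity_const (p j) (Y j) by exact: lt_le_trans (C1 j).
have B0 : 0 <= B.
  have := T_bound (fun j => modulus (y j)) (fun j => modulus_ge0 (y j)).
  have pos : 0 < \prod_(j < d) `|modulus (y j)| `^ (p j * theta j).
    by apply: prodr_gt0 => j _; rewrite powR_gt0// norm_modulus normr_gt0; exact: y0.
  rewrite -(pmulr_lge0 _ pos) -lee_fin; apply: le_trans; apply: integral_ge0 => x _.
  by rewrite lee_fin; apply: prodr_ge0 => j _; exact: powR_ge0.
have [phi [phi_good phi1 phiG]] := @disentangling_weights R disp X mu d theta
  (fun j => power_sums (T j) (p j) (p_convexity_const (p j) (Y j))) B theta_gt0 theta_sum
  (fun j => power_sums_neq0 _ _ _) (fun j g => @power_sums_good _ _ _ _ _ _ _ g)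
  (fun j g h t => @power_sums_convex _ _ _ _ _ _ _ g h t)
  (fun j => power_sums_saturates _ _ (T_saturates j))
  (fun g => power_sums_bound p_ge1 Y_convex T_linear T_positive theta_gt0 B0 C0 T_bound).
have [psi psiE] : exists psi : 'I_d -> {mfun X >-> R}, forall j x, psi j x = phi j x.
  have ex j : exists m : {mfun X >-> R}, forall x, m x = phi j x.
    pose m := isMeasurableFun.Build _ _ _ _ (phi j) (phi_good j).1.
    pose M : {mfun X >-> R} := HB.pack (phi j) m.
    by exists M.
  have [psi h] := choice ex; by exists psi.
exists psi; split.
- by move=> j x; rewrite psiE; have [_] := phi_good j.
- by apply: filterS phi1 => x; under [X in _ -> _ <= X]eq_bigr do rewrite psiE.
move=> j f; under eq_integral do rewrite psiE.
have p0 : 0 < p j by exact: lt_le_trans (p_ge1 j).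
have pn0 : p j != 0 by rewrite gt_eqF.
have [mphi phi0] := phi_good j.
have mTf := measurable_norm_powR (T j) (p j) f.
have mI : measurable_fun setT (fun x => `|T j f x| `^ p j * phi j x).
  exact: measurable_funM.
have I0 x : 0 <= `|T j f x| `^ p j * phi j x by rewrite mulr_ge0// powR_ge0.
have [f0|fn0] := eqVneq f 0.
  rewrite (_ : \int[mu]_x _ = 0)%E.
    by rewrite poweR0r ?invr_eq0// lee_fin mulr_ge0 ?mulr_ge0 ?powR_ge0 ?(ltW (C0 j)).
  rewrite -(integral0 mu setT); apply: ge0_ae_eq_integral => //.
  - exact/measurable_EFinP.
  - by move=> x _; rewrite lee_fin.
  apply: filterS (ae_linear0 (T_linear j)) => x Tx _.
  by rewrite f0 Tx normr0 powR0// mul0r.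
set A := p_convexity_const (p j) (Y j) * `|f|.
have A0 : 0 < A by rewrite mulr_gt0 ?normr_gt0//; exact: C0.
have Ap0 : 0 < A `^ p j by exact: powR_gt0.
have := phiG j _ (single_power_sum (T j) (p := p j) (C := p_convexity_const (p j) (Y j))
  (f := f) (c := (A `^ p j)^-1) _ _).
rewrite -/A mulVf ?gt_eqF// invr_ge0 (ltW Ap0) => /(_ isT (lexx _)).
have -> : (\int[mu]_x ((A `^ p j)^-1 * `|T j f x| `^ p j * phi j x)%:E =
    ((A `^ p j)^-1)%:E * \int[mu]_x (`|T j f x| `^ p j * phi j x)%:E)%E.
  under eq_integral do rewrite -mulrA EFinM.
  rewrite ge0_integralZl_EFin//; first by move=> x _; rewrite lee_fin.
    exact/measurable_EFinP.
  by rewrite invr_ge0 ltW.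
rewrite lee_pdivrMl// => le_I.
rewrite -mulrA -/A.
have -> : (B `^ (p j)^-1 * A)%:E = ((A `^ p j * B)%:E `^ (p j)^-1)%E.
  rewrite poweR_EFin powRM ?powR_ge0// -powRrM mulfV// powRr1 ?(ltW A0)//.
  by rewrite mulrC.
apply: gt0_ler_poweR; rewrite ?invr_ge0 ?(ltW p0)// in_itv/= leey andbT.
  by apply: integral_ge0 => x _; rewrite lee_fin.
by rewrite lee_fin mulr_ge0// powR_ge0.
Qed.
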